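(* The following are equivalent (in $\mathbf{ZF}$): (i) for every sequence $(X_n)_{n\in\omega}$ of non-void at most countable sets $X_n$, the product $\prod_{n\in\omega}X_n$ is non-void; (ii) for every discrete space $X$, the bornological universe $(X,[X]^{\le\omega})$ is metrizable if and only if $X$ is countable.
   Context: The set theory is $\mathbf{ZF}$ (no choice). A set is countable (equivalently, at most countable) if it is equipollent with a subset of $\omega$. A bornology in a set $X$ is a non-void ideal of subsets of $X$ (closed under subsets and finite unions) containing every singleton. $[X]^{\le\omega}$ is the bornology of all at most countable subsets of $X$. A bornological universe is a pair consisting of a topological space $(X,\tau)$ and a bornology $\mathcal{B}$ in $X$. It is metrizable (in the sense of Hu) if there is a metric $d$ on $X$ such that $\tau$ is the topology induced by $d$ and $\mathcal{B}=\{A\subseteq X:\mathrm{diam}_d(A)<+\infty\}$, where $\mathrm{diam}_d(A)=\sup\{d(x,y):x,y\in A\}$. *)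

(* Defs.v *)
(** "Provable in ZF" is rendered semantically: a claim is a theorem of ZF when
    it holds in every first-order structure [(V, ∈)] satisfying the ZF axioms.
    The Separation and Replacement schemes range over first-order formulas with
    parameters only; letting them range over all predicates [V -> Prop] would
    transfer the choice principles of the metatheory into [V].

    Every notion below is relativized to [V]: all quantifiers range over
    elements of [V]. *)

Record set_structure : Type := SetStructure {
  carrier :> Type;
  mem : carrier -> carrier -> Prop
}.

Arguments mem {s} _ _.
Notation "x ∈ y" := (mem x y) (at level 70, no associativity).
Notation "x ∉ y" := (~ mem x y) (at level 70, no associativity).

(** ** First-order formulas of the language of set theory *)

(** Variables are de Bruijn indices. *)
Inductive formula : Type :=
| fMem (i j : nat)
| fEq (i j : nat)
| fFalse
| fAnd (p q : formula)
| fOr (p q : formula)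
| fImp (p q : formula)
| fAll (p : formula)
| fEx (p : formula).

Definition scons {A : Type} (x : A) (e : nat -> A) (n : nat) : A :=
  match n with O => x | S m => e m end.

Fixpoint sat {V : set_structure} (e : nat -> V) (p : formula) : Prop :=
  match p with
  | fMem i j => e i ∈ e j
  | fEq i j => e i = e j
  | fFalse => False
  | fAnd p q => sat e p /\ sat e q
  | fOr p q => sat e p \/ sat e q
  | fImp p q => sat e p -> sat e q
  | fAll p => forall x : V, sat (scons x e) p
  | fEx p => exists x : V, sat (scons x e) p
  end.

(** ** Basic set-theoretic vocabulary *)

Section Vocabulary.
Context {V : set_structure}.
Implicit Types x y z p f n w A B C F I X : V.

Definition is_empty x : Prop := forall z, z ∉ x.
Definition nonvoid x : Prop := exists z, z ∈ x.
Definition subset x y : Prop := forall z, z ∈ x -> z ∈ y.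

Definition is_upair p x y : Prop := forall z, z ∈ p <-> z = x \/ z = y.
Definition is_singleton p x : Prop := forall z, z ∈ p <-> z = x.
Definition is_union2 C A B : Prop := forall z, z ∈ C <-> z ∈ A \/ z ∈ B.
Definition is_inter2 C A B : Prop := forall z, z ∈ C <-> z ∈ A /\ z ∈ B.
Definition is_union C F : Prop := forall z, z ∈ C <-> exists A, A ∈ F /\ z ∈ A.
Definition is_power C A : Prop := forall z, z ∈ C <-> subset z A.

(** Kuratowski pairs: [p = {{x}, {x, y}}]. *)
Definition is_opair p x y : Prop :=
  forall z, z ∈ p <-> is_singleton z x \/ is_upair z x y.

Definition is_prod C A B : Prop :=
  forall p, p ∈ C <-> exists x y, x ∈ A /\ y ∈ B /\ is_opair p x y.

(** [y = x ∪ {x}]. *)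
Definition is_succ y x : Prop := forall z, z ∈ y <-> z ∈ x \/ z = x.

Definition inductive w : Prop :=
  (exists z, is_empty z /\ z ∈ w) /\
  (forall x, x ∈ w -> exists y, is_succ y x /\ y ∈ w).

Definition is_nat n : Prop := forall w, inductive w -> n ∈ w.
Definition is_omega w : Prop := forall n, n ∈ w <-> is_nat n.

(** [f(x) = y], i.e. [(x, y) ∈ f]. *)
Definition value f x y : Prop := exists p, is_opair p x y /\ p ∈ f.

Definition is_fun f A B : Prop :=
  (forall p, p ∈ f -> exists x y, x ∈ A /\ y ∈ B /\ is_opair p x y) /\
  (forall x, x ∈ A -> exists! y, value f x y).

Definition is_bijection f A B : Prop :=
  is_fun f A B /\
  (forall x x' y, value f x y -> value f x' y -> x = x') /\
  (forall y, y ∈ B -> exists x, value f x y).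

Definition equipollent A B : Prop := exists f, is_bijection f A B.

Definition countable A : Prop :=
  exists w B, is_omega w /\ subset B w /\ equipollent A B.

Definition is_family F I : Prop := exists C, is_fun F I C.

(** [f ∈ ∏_(i ∈ I) F(i)]. *)
Definition in_product f F I : Prop :=
  is_family f I /\
  (forall i A x, i ∈ I -> value F i A -> value f i x -> x ∈ A).

End Vocabulary.

(** ** The axioms of ZF *)

Record ZF (V : set_structure) : Prop := {
  zf_extensionality : forall x y : V, (forall z, z ∈ x <-> z ∈ y) -> x = y;
  zf_foundation : forall x : V, nonvoid x ->
    exists y, y ∈ x /\ forall z, ~ (z ∈ x /\ z ∈ y);
  zf_pairing : forall x y : V, exists p, is_upair p x y;
  zf_union : forall F : V, exists C, is_union C F;
  zf_power : forall A : V, exists C, is_power C A;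
  zf_infinity : exists w : V, inductive w;
  zf_separation : forall (p : formula) (e : nat -> V) (A : V),
    exists B, forall x, x ∈ B <-> x ∈ A /\ sat (scons x e) p;
  zf_replacement : forall (p : formula) (e : nat -> V) (A : V),
    (forall x y y', x ∈ A -> sat (scons x (scons y e)) p ->
       sat (scons x (scons y' e)) p -> y = y') ->
    exists B, forall y,
      y ∈ B <-> exists x, x ∈ A /\ sat (scons x (scons y e)) p
}.

(** ** The real numbers of [V] *)

Section Reals.
Context {V : set_structure}.
Implicit Types f w a b c k m n q r s t x y z : V.

(** [m + n = k] in [ω], by recursion on [n]. *)
Definition nat_add m n k : Prop :=
  exists w f, is_omega w /\ is_fun f w w /\
    (forall z, is_empty z -> value f z m) /\
    (forall i i' j j', value f i j -> is_succ i' i -> is_succ j' j ->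
       value f i' j') /\
    value f n k.

(** [m * n = k] in [ω], by recursion on [n]. *)
Definition nat_mul m n k : Prop :=
  is_nat m /\
  exists w f, is_omega w /\ is_fun f w w /\
    (forall z, is_empty z -> value f z z) /\
    (forall i i' j j', value f i j -> is_succ i' i -> nat_add j m j' ->
       value f i' j') /\
    value f n k.

(** [a * b + c * d = k] in [ω]. *)
Definition nat_lin a b c d k : Prop :=
  exists x y, nat_mul a b x /\ nat_mul c d y /\ nat_add x y k.

(** [q = ((a, b), c)] with [a, b, c ∈ ω] and [c <> 0], a formal fraction
    standing for the rational [(a - b) / c]. Formal fractions are only
    preordered. A Dedekind cut in them is closed under equality of the
    represented rationals, because it is downward closed for [frac_lt] and has
    no greatest element; so cuts of formal fractions correspond exactly to cuts
    of rationals. *)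
Definition frac q a b c : Prop :=
  is_nat a /\ is_nat b /\ is_nat c /\ ~ is_empty c /\
  exists p, is_opair p a b /\ is_opair q p c.

Definition is_frac q : Prop := exists a b c, frac q a b c.

(** [(a - b) / c < (a' - b') / c'] iff [a c' + b' c < a' c + b c'];
    on [ω] the strict order is [∈]. *)
Definition frac_lt q q' : Prop :=
  exists a b c a' b' c' l r,
    frac q a b c /\ frac q' a' b' c' /\
    nat_lin a c' b' c l /\ nat_lin a' c b c' r /\ l ∈ r.

(** [(a - b) / c + (a' - b') / c' = ((a c' + a' c) - (b c' + b' c)) / (c c')]. *)
Definition frac_add q q' s : Prop :=
  exists a b c a' b' c' a'' b'' c'',
    frac q a b c /\ frac q' a' b' c' /\ frac s a'' b'' c'' /\
    nat_lin a c' a' c a'' /\ nat_lin b c' b' c b'' /\ nat_mul c c' c''.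

(** Extended reals are lower Dedekind cuts, including the empty cut [-oo] and
    the cut [+oo] consisting of all fractions; the order is inclusion. *)
Definition ext_real r : Prop :=
  (forall q, q ∈ r -> is_frac q) /\
  (forall q q', q ∈ r -> frac_lt q' q -> q' ∈ r) /\
  (forall q, q ∈ r -> exists q', q' ∈ r /\ frac_lt q q').

Definition is_pinfty r : Prop := forall q, q ∈ r <-> is_frac q.

Definition is_real r : Prop :=
  ext_real r /\ nonvoid r /\ (exists q, is_frac q /\ q ∉ r).

Definition is_reals R : Prop := forall r : V, r ∈ R <-> is_real r.

Definition real_le r s : Prop := subset r s.
Definition real_lt r s : Prop := real_le r s /\ r <> s.

Definition is_zero r : Prop :=
  forall q, q ∈ r <-> exists a b c, frac q a b c /\ a ∈ b.

(** [r + s = t] for cuts: the fractions lying below some [x + y] with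
    [x ∈ r] and [y ∈ s]. *)
Definition real_add r s t : Prop :=
  forall q, q ∈ t <->
    exists x y z, x ∈ r /\ y ∈ s /\ frac_add x y z /\ frac_lt q z.

Definition is_pos r : Prop :=
  is_real r /\ exists z, is_zero z /\ real_lt z r.
Definition is_nonneg r : Prop :=
  is_real r /\ exists z, is_zero z /\ real_le z r.

End Reals.

(** ** Topologies, bornologies and metrizability *)

Section Bornology.
Context {V : set_structure}.
Implicit Types x y z d r s t e P R A B C F U X T : V.

Definition is_topology T X : Prop :=
  (forall U, U ∈ T -> subset U X) /\
  (forall U, is_empty U -> U ∈ T) /\
  X ∈ T /\
  (forall F U, subset F T -> is_union U F -> U ∈ T) /\
  (forall U U' C, U ∈ T -> U' ∈ T -> is_inter2 C U U' -> C ∈ T).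

Definition discrete_space X T : Prop :=
  is_topology T X /\ (forall U, subset U X -> U ∈ T).

Definition is_bornology B X : Prop :=
  (forall A, A ∈ B -> subset A X) /\
  nonvoid B /\
  (forall A A', A ∈ B -> subset A' A -> A' ∈ B) /\
  (forall A A' C, A ∈ B -> A' ∈ B -> is_union2 C A A' -> C ∈ B) /\
  (forall x C, x ∈ X -> is_singleton C x -> C ∈ B).

Definition bornological_universe X T B : Prop :=
  is_topology T X /\ is_bornology B X.

(** [B = [X]^(<= ω)]. *)
Definition is_countable_subsets B X : Prop :=
  forall A, A ∈ B <-> subset A X /\ countable A.

(** [d(x, y) = r]. *)
Definition dist d x y r : Prop := exists p, is_opair p x y /\ value d p r.

Definition is_metric d X : Prop :=
  (exists P R, is_prod P X X /\ is_reals R /\ is_fun d P R) /\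
  (forall x y r, dist d x y r -> is_nonneg r) /\
  (forall x y r, dist d x y r -> (is_zero r <-> x = y)) /\
  (forall x y r, dist d x y r -> dist d y x r) /\
  (forall x y z r s t, dist d x z r -> dist d x y s -> dist d y z t ->
     exists u, real_add s t u /\ real_le r u).

Definition is_induced_topology T X d : Prop :=
  forall U, U ∈ T <->
    subset U X /\
    forall x, x ∈ U -> exists e, is_pos e /\
      forall y r, y ∈ X -> dist d x y r -> real_lt r e -> y ∈ U.

(** [s = diam_d(A)], the supremum being taken among the extended reals. *)
Definition is_diam s d A : Prop :=
  let ub t := forall x y r, x ∈ A -> y ∈ A -> dist d x y r -> real_le r t in
  ext_real s /\ ub s /\ (forall t, ext_real t -> ub t -> real_le s t).

Definition finite_diam d A : Prop :=
  exists s t, is_diam s d A /\ is_pinfty t /\ real_lt s t.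

Definition metrizable X T B : Prop :=
  bornological_universe X T B /\
  exists d, is_metric d X /\ is_induced_topology T X d /\
    (forall A, A ∈ B <-> subset A X /\ finite_diam d A).

End Bornology.

(* Main.v *)
(** Suppose choice holds for sequences of countable sets and let [d] metrize
    the countable bornology of a discrete space [X]. If [X] were unbounded,
    choosing a point in each nonvoid annulus [n < d(x0, x) <= n + 1] would give
    a countable unbounded set; so [X] is bounded, hence countable.

    Conversely, given nonvoid countable sets [F 0, F 1, ...], let [Y] be the set
    of all choice functions for finite initial segments, metrized by
    [d(g, h) = max(|g|, |h|) + 1] for [g <> h]. Sets of choice functions of
    bounded length are countable. An unbounded countable subset of [Y] yields a
    choice function for all of [F]: enumerate the subset and take at [n] the value
    of its first member of length [> n]. If there is no choice function, then the
    countable subsets of [Y] are exactly the bounded ones, so [Y] is metrizable,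
    hence countable, hence bounded, which is absurd.

    Separation and replacement are only available for first-order formulas, so
    every set-forming step comes with a proof that its predicate is definable;
    these proofs are found by instance resolution for [Definable] and [DTerm]. *)

From Stdlib Require Import Arith Lia Classical ClassicalEpsilon Ring.
Require Import Defs.

(** The obstacle is to keep choice out of the set-forming steps. Witnesses enter terms of [V] only
    through the default [some_set] and through [the], a definite description, so the sets built
    remain first-order definable; where one member of a countable set must be singled out, it is the
    one of least code under a fixed injection into ω.

    Neither direction uses that a countable union of countable sets is countable. An annulus is
    countable because it is bounded for the given metric. Choice functions of length [n] are shown
    countable by induction on [n], which yields an enumeration for each [n] but no sequence of
    enumerations.

    Real arithmetic is reduced to cuts at natural numbers: the given metric is compared with integer
    radii only, and the constructed one has natural values. Taking the maximum of the lengths makes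
    it an ultrametric with bounded sets of bounded length; the added 1 keeps distinct points at
    distance at least 1, which makes the topology discrete. *)

Fixpoint ren (f : nat -> nat) (p : formula) : formula :=
  let up := fun i => match i with O => O | S j => S (f j) end in
  match p with
  | fMem i j => fMem (f i) (f j)
  | fEq i j => fEq (f i) (f j)
  | fFalse => fFalse
  | fAnd p q => fAnd (ren f p) (ren f q)
  | fOr p q => fOr (ren f p) (ren f q)
  | fImp p q => fImp (ren f p) (ren f q)
  | fAll p => fAll (ren up p)
  | fEx p => fEx (ren up p)
  end.

Lemma sat_ren {V : set_structure} p : forall f (e e' : nat -> V),
  (forall i, e' i = e (f i)) -> (sat e (ren f p) <-> sat e' p).
Proof.
  induction p; intros f e e' H; simpl;
    try (rewrite ?H; tauto);
    try (rewrite (IHp1 f e e' H), (IHp2 f e e' H); tauto).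
  - split; intros K x; generalize (K x); apply IHp;
      intros [|i]; simpl; auto.
  - split; intros [x K]; exists x; revert K; apply IHp;
      intros [|i]; simpl; auto.
Qed.

(* Even variables are read from [e]; odd ones are parameters, read from [q]. *)
Definition mix {A : Type} (e q : nat -> A) (n : nat) : A :=
  if Nat.even n then e (Nat.div2 n) else q (Nat.div2 n).

Existing Class ZF.

(** * Definable predicates and terms *)

Section Definability.
Context {V : set_structure} {hV : ZF V}.
Notation env := (nat -> V).

(** The parameters [q] form an infinite sequence, of which a formula reads only finitely many; the
    parameters of two formulas can then be interleaved without counting free variables. *)
Class Definable (P : env -> Prop) : Prop :=
  is_definable : exists p q, forall e, sat (mix e q) p <-> P e.

(** The language has no function symbols, so a term is represented by its graph: the value sits in
    slot 0 and the arguments are shifted by one. *)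
Class DTerm (t : env -> V) : Prop :=
  is_dterm : Definable (fun e => e 0 = t (fun n => e (S n))).

Lemma definable_ext P Q : (forall e, P e <-> Q e) -> Definable P -> Definable Q.
Proof.
  intros H [p [q K]]; exists p, q; intros e; rewrite K; apply H.
Qed.

Lemma mix_even (e q : env) i : mix e q (2 * i) = e i.
Proof.
  unfold mix. rewrite Nat.even_mul, Nat.div2_double. reflexivity.
Qed.
Lemma mix_odd (e q : env) i : mix e q (S (2 * i)) = q i.
Proof.
  unfold mix. rewrite Nat.even_succ, <- Nat.negb_even, Nat.even_mul. cbn [negb orb].
  rewrite Nat.div2_succ_double. reflexivity.
Qed.

Lemma parity i : exists j, i = 2 * j \/ i = S (2 * j).
Proof.
  destruct (Nat.Even_or_Odd i) as [[j H]|[j H]]; exists j; lia.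
Qed.

Lemma definable_reindex (f : nat -> nat) P :
  Definable P -> Definable (fun e => P (fun n => e (f n))).
Proof.
  intros [p [q H]].
  exists (ren (fun i => if Nat.even i then 2 * f (Nat.div2 i) else i) p), q.
  intros e; rewrite <- H; apply sat_ren; intros i.
  unfold mix at 1; destruct (Nat.even i) eqn:E.
  - now rewrite mix_even.
  - unfold mix. now rewrite E.
Qed.

Lemma definable_reparam (f : nat -> nat) p (q q' : env) e :
  (forall i, q i = q' (f i)) ->
  sat (mix e q) p <->
  sat (mix e q') (ren (fun i => if Nat.even i then i else S (2 * f (Nat.div2 i))) p).
Proof.
  intros H; symmetry; apply sat_ren; intros i.
  unfold mix at 1; destruct (Nat.even i) eqn:E.
  - unfold mix. now rewrite E.
  - rewrite mix_odd. apply H.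
Qed.

(** The two formulas come with their own parameters; [q] is moved to the even and [q'] to the odd
    positions of a joint sequence. *)
Lemma definable_op (op : Prop -> Prop -> Prop) (fop : formula -> formula -> formula) P Q :
  (forall (e : env) p q, sat e (fop p q) <-> op (sat e p) (sat e q)) ->
  (forall A B A' B', (A <-> A') -> (B <-> B') -> (op A B <-> op A' B')) ->
  Definable P -> Definable Q -> Definable (fun e => op (P e) (Q e)).
Proof.
  intros Hop Hext [p [q H]] [p' [q' H']].
  eexists (fop (ren _ p) (ren _ p')), (mix q q').
  intros e; rewrite Hop; apply Hext.
  - rewrite <- H, (definable_reparam (fun i => 2 * i) p q (mix q q')).
    + reflexivity.
    + intros i; now rewrite mix_even.
  - rewrite <- H', (definable_reparam (fun i => S (2 * i)) p' q' (mix q q')).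
    + reflexivity.
    + intros i; now rewrite mix_odd.
Qed.

#[export] Instance definable_and P Q :
  Definable P -> Definable Q -> Definable (fun e => P e /\ Q e).
Proof. apply (definable_op and fAnd); simpl; tauto. Qed.
#[export] Instance definable_or P Q :
  Definable P -> Definable Q -> Definable (fun e => P e \/ Q e).
Proof. apply (definable_op or fOr); simpl; tauto. Qed.
#[export] Instance definable_imp P Q :
  Definable P -> Definable Q -> Definable (fun e => P e -> Q e).
Proof. apply (definable_op (fun A B => A -> B) fImp); simpl; tauto. Qed.
#[export] Instance definable_iff P Q :
  Definable P -> Definable Q -> Definable (fun e => P e <-> Q e).
Proof. unfold iff; intros; apply definable_and; apply definable_imp; assumption. Qed.

Definition some_set : V :=
  proj1_sig (constructive_indefinite_description _ (zf_infinity V hV)).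

(** A proposition of the metatheory that ignores the environment is true or false by excluded
    middle, hence equivalent to a closed formula. *)
#[export] Instance definable_const (P : Prop) : Definable (fun _ => P) | 0.
Proof.
  destruct (classic P).
  - exists (fImp fFalse fFalse), (fun _ => some_set); simpl; tauto.
  - exists fFalse, (fun _ => some_set); simpl; tauto.
Qed.

#[export] Instance definable_not P :
  Definable P -> Definable (fun e => ~ P e).
Proof. intros; unfold not; apply definable_imp; exact _ || apply definable_const. Qed.

Lemma mem_var i j : Definable (fun e => e i ∈ e j).
Proof.
  exists (fMem (2 * i) (2 * j)), (fun _ => some_set); intros e; cbn [sat].
  rewrite !mix_even; reflexivity.
Qed.

Lemma eq_var i j : Definable (fun e => e i = e j).
Proof.
  exists (fEq (2 * i) (2 * j)), (fun _ => some_set); intros e; cbn [sat].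
  rewrite !mix_even; reflexivity.
Qed.

(** A quantifier prepends [x] to [mix e q] and moves every slot by one, whereas in
    [mix (scons x e) q] the old variables move by two and the parameters stay. So a parameter is
    read one place further and an old variable one place earlier. *)
Lemma scons_mix x (e q : env) i :
  mix (scons x e) q i =
  scons x (mix e q) (match i with O => O | S j => if Nat.even j then S i else j end).
Proof.
  destruct i as [|i]; [reflexivity|].
  destruct (parity i) as [j [->| ->]].
  - rewrite mix_odd.
    replace (Nat.even (2 * j)) with true by (now rewrite Nat.even_mul).
    symmetry; exact (mix_odd e q j).
  - replace (Nat.even (S (2 * j))) with false
      by (now rewrite Nat.even_succ, <- Nat.negb_even, Nat.even_mul).
    replace (S (S (2 * j))) with (2 * S j) by lia. rewrite mix_even.
    symmetry; exact (mix_even e q j).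
Qed.

#[export] Instance definable_all (Q : env -> V -> Prop) :
  Definable (fun e => Q (fun n => e (S n)) (e 0)) -> Definable (fun e => forall x, Q e x).
Proof.
  intros [p [q H]]. eexists (fAll (ren _ p)), q.
  intros e; cbn [sat]; split; intros K x.
  - apply (H (scons x e)). generalize (K x). apply sat_ren, scons_mix.
  - generalize (proj2 (H (scons x e)) (K x)). apply sat_ren, scons_mix.
Qed.

#[export] Instance definable_ex (Q : env -> V -> Prop) :
  Definable (fun e => Q (fun n => e (S n)) (e 0)) -> Definable (fun e => exists x, Q e x).
Proof.
  intros [p [q H]]. eexists (fEx (ren _ p)), q.
  intros e; cbn [sat]; split; intros [x K]; exists x.
  - apply (H (scons x e)). generalize K. apply sat_ren, scons_mix.
  - generalize (proj2 (H (scons x e)) K). apply sat_ren, scons_mix.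
Qed.

#[export] Instance dterm_var i : DTerm (fun e => e i) | 0.
Proof. apply eq_var. Qed.

#[export] Instance dterm_const a : DTerm (fun _ => a) | 0.
Proof.
  exists (fEq 0 1), (fun _ => a); reflexivity.
Qed.

Lemma dterm_reindex (f : nat -> nat) t :
  DTerm t -> DTerm (fun e => t (fun n => e (f n))).
Proof.
  intros H.
  exact (definable_reindex (fun n => match n with O => O | S k => S (f k) end) _ H).
Qed.

Lemma definable_subst (Q : env -> V -> Prop) t : DTerm t ->
  Definable (fun e => Q (fun n => e (S n)) (e 0)) -> Definable (fun e => Q e (t e)).
Proof.
  intros Ht HQ.
  apply definable_ext with (fun e => exists x, x = t e /\ Q e x).
  - intros e; split; [intros [x [-> K]]; exact K|intros K; exists (t e); auto].
  - apply definable_ex, definable_and; [exact Ht|exact HQ].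
Qed.

#[export] Instance definable_mem t u :
  DTerm t -> DTerm u -> Definable (fun e => t e ∈ u e).
Proof.
  intros Ht Hu.
  apply (definable_subst (fun e x => x ∈ u e) t Ht).
  apply (definable_subst (fun e y => e 0 ∈ y) _ (dterm_reindex S u Hu)).
  apply mem_var.
Qed.

#[export] Instance definable_eq t u :
  DTerm t -> DTerm u -> Definable (fun e => t e = u e).
Proof.
  intros Ht Hu.
  apply (definable_subst (fun e x => x = u e) t Ht). exact Hu.
Qed.

Lemma definable_shift P : Definable P -> Definable (fun e => P (fun n => e (S n))).
Proof. apply (definable_reindex S). Qed.

#[export] Instance definable_unique (Q : env -> V -> Prop) t : DTerm t ->
  Definable (fun e => Q (fun n => e (S n)) (e 0)) ->
  Definable (fun e => unique (Q e) (t e)).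
Proof.
  intros Ht HQ. unfold unique. apply definable_and.
  - now apply definable_subst.
  - apply definable_all, definable_imp; [exact HQ|].
    apply definable_eq; [now apply (dterm_reindex S)|exact _].
Qed.

End Definability.

(* Otherwise instance resolution would see through these names and unfold them
   at every node of a formula. *)
#[export] Typeclasses Opaque is_empty nonvoid subset is_upair is_singleton is_union2
  is_union is_power is_opair is_succ inductive is_nat is_omega value is_fun
  is_bijection equipollent countable nat_add nat_mul nat_lin frac is_frac frac_lt
  frac_add ext_real is_real dist.

(* A predicate or term that is assumed definable reappears under binders with a
   shifted environment; these hints recognize it there. *)
#[export] Hint Extern 0 (Definable (fun e => ?P (fun n => e (@?f n)))) =>
  apply (definable_reindex f P) : typeclass_instances.
#[export] Hint Extern 0 (DTerm (fun e => ?t (fun n => e (@?f n)))) =>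
  apply (dterm_reindex f t) : typeclass_instances.

#[export] Hint Extern 5 (Definable _) =>
  progress unfold is_empty, nonvoid, subset, is_upair, is_singleton, is_union2,
    is_union, is_power, is_opair, is_succ, inductive, is_nat, is_omega, value,
    is_fun, nat_add, nat_mul, nat_lin, frac, is_frac, frac_lt, frac_add
    : typeclass_instances.

(** * Definable set operations *)

Section SetOperations.
Context {V : set_structure} {hV : ZF V}.

Lemma set_ext (x y : V) : (forall z, z ∈ x <-> z ∈ y) -> x = y.
Proof. apply (zf_extensionality V hV). Qed.

(** The predicate depends on variable 0 only, so all even slots may be renamed to the candidate
    element. *)
Lemma separation (P : V -> Prop) (A : V) : Definable (fun e => P (e 0)) ->
  exists B, forall x, x ∈ B <-> x ∈ A /\ P x.
Proof.
  intros [p [q H]].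
  destruct (zf_separation V hV
    (ren (fun i => if Nat.even i then 0 else S (Nat.div2 i)) p) q A) as [B HB].
  exists B; intros x; rewrite HB. apply and_iff_compat_l.
  rewrite <- (H (fun _ => x)). apply sat_ren.
  intros i; unfold mix; destruct (Nat.even i); reflexivity.
Qed.

Lemma replacement (t : V -> V) (A : V) : DTerm (fun e => t (e 0)) ->
  exists B, forall y, y ∈ B <-> exists x, x ∈ A /\ y = t x.
Proof.
  intros [p [q H]].
  (* In the graph of [t], variable 0 is the value and the others are the argument; replacement puts
     the argument in slot 0 and the value in slot 1, so the two are exchanged. *)
  pose (f i := if Nat.even i then (match Nat.div2 i with O => 1 | _ => 0 end)
               else S (S (Nat.div2 i))).
  assert (K : forall x y, sat (scons x (scons y q)) (ren f p) <-> y = t x).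
  { intros x y.
    rewrite <- (H (fun i => match i with O => y | _ => x end)). apply sat_ren.
    intros i; unfold f, mix; destruct (Nat.even i); [destruct (Nat.div2 i)|]; reflexivity. }
  destruct (zf_replacement V hV (ren f p) q A) as [B HB].
  - intros x y y' _; rewrite !K; congruence.
  - exists B; intros y; rewrite HB. split; intros [x Hx]; exists x; revert Hx; rewrite K; auto.
Qed.

(* The junk value, when [P] has no unique witness, must itself be a parameter so
   that descriptions are definable terms. *)
Definition the (P : V -> Prop) : V :=
  match excluded_middle_informative (exists x, unique P x) with
  | left h => proj1_sig (constructive_indefinite_description _ h)
  | right _ => some_set
  end.

Lemma the_spec P : (exists! x, P x) -> P (the P).
Proof.
  intros h; unfold the; destruct (excluded_middle_informative (exists x, unique P x)) as [h1|h1]; [|contradiction].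
  destruct constructive_indefinite_description as [x Hx]; apply Hx.
Qed.

Lemma the_eq (P : V -> Prop) x : P x -> (forall y, P y -> y = x) -> the P = x.
Proof.
  intros Hx H; apply H, the_spec; exists x; split; [exact Hx|].
  intros y Hy; symmetry; auto.
Qed.

(** The graph of a description is first-order: the value is the unique witness, or there is none and
    the value is the constant [some_set]. Metatheoretic epsilon thus makes no choice that [V] could
    not express. *)
#[export] Instance dterm_the (Q : (nat -> V) -> V -> Prop) :
  Definable (fun e => Q (fun n => e (S n)) (e 0)) -> DTerm (fun e => the (Q e)).
Proof.
  intros HQ.
  (* [K] expresses that a unique witness exists, [L] that variable 0 is one. The reindexing skips
     slot 1, which the additional variable occupies. *)
  pose proof (definable_shift _ (definable_ex (fun e x => unique (Q e) x)
    (definable_unique (fun e x => Q (fun n => e (S n)) x) _ (dterm_var 0)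
      (definable_reindex (fun n => match n with O => O | S k => S (S k) end) _ HQ)))) as K.
  pose proof (definable_unique (fun e x => Q (fun n => e (S n)) x) _ (dterm_var 0)
      (definable_reindex (fun n => match n with O => O | S k => S (S k) end) _ HQ)) as L.
  cbv beta in K, L.
  refine (definable_ext _ _ _ (definable_or _ _ L (definable_and _ _ (definable_not _ K)
    (definable_eq _ _ (dterm_var 0) (dterm_const some_set))))).
  intros e; cbv beta. unfold the.
  destruct excluded_middle_informative as [h|h].
  - destruct constructive_indefinite_description as [x Hx]; cbn.
    split.
    + intros [H|[H _]]; [|contradiction]. symmetry; apply Hx, H.
    + intros ->; left; exact Hx.
  - split.
    + intros [H|[_ H]]; [|exact H]. destruct h; eauto.
    + intros H; right; auto.
Qed.

Definition sep (A : V) (P : V -> Prop) : V := the (fun B => forall x, x ∈ B <-> x ∈ A /\ P x).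
Definition image (A : V) (t : V -> V) : V :=
  the (fun B => forall y, y ∈ B <-> exists x, x ∈ A /\ y = t x).
Definition upair (x y : V) : V := the (fun p => is_upair p x y).
Definition pair (x y : V) : V := the (fun p => is_opair p x y).
Definition power (A : V) : V := the (fun C => is_power C A).
Definition union (F : V) : V := the (fun C => is_union C F).
Definition empty : V := the is_empty.
Definition succ (x : V) : V := the (fun y => is_succ y x).
Definition omega : V := the is_omega.
Definition app (f x : V) : V := the (fun y => value f x y).
Definition lam (A : V) (t : V -> V) : V := image A (fun x => pair x (t x)).
(** A description instead of a conditional of the metatheory, so that its definability follows from
    that of [the]. *)
Definition ite (P : Prop) (a b : V) : V := the (fun k => P /\ k = a \/ ~ P /\ k = b).
Definition union2 (A B : V) : V := union (upair A B).
Definition prod (A B : V) : V :=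
  sep (power (power (union2 A B))) (fun p => exists x y, x ∈ A /\ y ∈ B /\ p = pair x y).

#[export] Instance dterm_sep A (Q : (nat -> V) -> V -> Prop) : DTerm A ->
  Definable (fun e => Q (fun n => e (S n)) (e 0)) -> DTerm (fun e => sep (A e) (Q e)).
Proof.
  intros HA HQ. unfold sep.
  pose proof (definable_reindex (fun n => match n with O => O | S k => S (S k) end) _ HQ).
  cbv beta in H.
  exact _.
Qed.

#[export] Instance dterm_image A (t : (nat -> V) -> V -> V) : DTerm A ->
  DTerm (fun e => t (fun n => e (S n)) (e 0)) -> DTerm (fun e => image (A e) (t e)).
Proof.
  intros HA Ht. unfold image.
  pose proof (dterm_reindex (fun n => match n with O => O | S k => S (S (S k)) end) _ Ht).
  cbv beta in H.
  exact _.
Qed.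

#[export] Instance dterm_pair x y : DTerm x -> DTerm y -> DTerm (fun e => pair (x e) (y e)).
Proof. unfold pair; exact _. Qed.
#[export] Instance dterm_succ x : DTerm x -> DTerm (fun e => succ (x e)).
Proof. unfold succ; exact _. Qed.
#[export] Instance dterm_app x y : DTerm x -> DTerm y -> DTerm (fun e => app (x e) (y e)).
Proof. unfold app; exact _. Qed.
#[export] Instance dterm_lam A (t : (nat -> V) -> V -> V) : DTerm A ->
  DTerm (fun e => t (fun n => e (S n)) (e 0)) -> DTerm (fun e => lam (A e) (t e)).
Proof. unfold lam; exact _. Qed.
#[export] Instance dterm_ite P x y :
  Definable P -> DTerm x -> DTerm y -> DTerm (fun e => ite (P e) (x e) (y e)).
Proof. unfold ite; exact _. Qed.

#[export] Typeclasses Opaque the sep image upair pair power union empty succ omega app lam ite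
  union2 prod.

End SetOperations.

(** * Membership in the described sets, pairs and functions *)

Section Arithmetic.
Context {V : set_structure} {hV : ZF V}.
Implicit Types x y z p f n w A B C F : V.

(** Extensionality provides uniqueness, so existence of a set with the prescribed elements is all
    that has to be shown. *)
Lemma the_ext_spec (Q : V -> Prop) :
  (exists B, forall x, x ∈ B <-> Q x) ->
  forall x, x ∈ the (fun B => forall x, x ∈ B <-> Q x) <-> Q x.
Proof.
  intros [B HB]. apply (the_spec (fun B => forall x, x ∈ B <-> Q x)).
  exists B; split; [exact HB|]. intros C HC; apply set_ext; intros z.
  now rewrite HB, HC.
Qed.

Lemma in_sep A (P : V -> Prop) : Definable (fun e => P (e 0)) ->
  forall x, x ∈ sep A P <-> x ∈ A /\ P x.
Proof. intros H; apply the_ext_spec, separation, H. Qed.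

Lemma in_image A (t : V -> V) : DTerm (fun e => t (e 0)) ->
  forall y, y ∈ image A t <-> exists x, x ∈ A /\ y = t x.
Proof. intros H; apply the_ext_spec, replacement, H. Qed.

Lemma in_upair x y z : z ∈ upair x y <-> z = x \/ z = y.
Proof. revert z; unfold upair, is_upair; apply the_ext_spec, (zf_pairing V hV). Qed.

Lemma in_power x z : z ∈ power x <-> subset z x.
Proof. revert z; unfold power, is_power; apply the_ext_spec, (zf_power V hV). Qed.

Lemma in_union F z : z ∈ union F <-> exists A, A ∈ F /\ z ∈ A.
Proof. revert z; unfold union, is_union; apply the_ext_spec, (zf_union V hV). Qed.

Lemma in_union2 A B z : z ∈ union2 A B <-> z ∈ A \/ z ∈ B.
Proof.
  unfold union2; rewrite in_union; split.
  - intros [C [HC Hz]]; apply in_upair in HC as [->| ->]; auto.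
  - intros [H|H]; [exists A|exists B]; rewrite in_upair; auto.
Qed.

Lemma not_in_empty z : z ∉ empty.
Proof.
  assert (H : is_empty empty); [|apply H].
  apply (the_spec is_empty). destruct (separation (fun _ => False) some_set _) as [B HB].
  exists B; split; [intros x; rewrite HB; tauto|].
  intros C HC; apply set_ext; intros x; rewrite HB; specialize (HC x); tauto.
Qed.

Lemma is_emptyE x : is_empty x <-> x = empty.
Proof.
  split; [|intros ->; exact not_in_empty].
  intros H; apply set_ext; intros z; specialize (H z); generalize (not_in_empty z); tauto.
Qed.

Lemma is_upairE p x y : is_upair p x y <-> p = upair x y.
Proof.
  split; [|intros ->; exact (in_upair x y)].
  intros H; apply set_ext; intros z; now rewrite (H z), in_upair.
Qed.

Lemma is_singletonE p x : is_singleton p x <-> p = upair x x.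
Proof.
  rewrite <- is_upairE; unfold is_singleton, is_upair.
  split; intros H z; rewrite H; tauto.
Qed.

Lemma is_opairE p x y : is_opair p x y <-> p = pair x y.
Proof.
  assert (H : forall p, is_opair p x y <-> p = upair (upair x x) (upair x y)).
  { intros q; rewrite <- is_upairE; unfold is_opair; split; intros H z; rewrite (H z);
    rewrite is_singletonE, is_upairE; reflexivity. }
  rewrite H. replace (pair x y) with (upair (upair x x) (upair x y)); [reflexivity|].
  symmetry; apply the_eq; [now apply H|]. intros q; apply H.
Qed.

Lemma upair_inj x y x' y' : upair x y = upair x' y' -> x = x' /\ y = y' \/ x = y' /\ y = x'.
Proof.
  intros H.
  assert (K : forall z, z = x \/ z = y <-> z = x' \/ z = y')
    by (intros z; rewrite <- !in_upair, H; reflexivity).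
  generalize (proj1 (K x)), (proj1 (K y)), (proj2 (K x')), (proj2 (K y')); intuition congruence.
Qed.

Lemma pair_inj x y x' y' : pair x y = pair x' y' -> x = x' /\ y = y'.
Proof.
  assert (E : forall x y, pair x y = upair (upair x x) (upair x y)).
  { intros a b; apply the_eq.
    - intros z; now rewrite in_upair, is_singletonE, is_upairE.
    - intros q Hq; apply set_ext; intros z; now rewrite (Hq z), in_upair, is_singletonE, is_upairE. }
  rewrite !E; intros H; apply upair_inj in H as [[H1 H2]|[H1 H2]];
    apply upair_inj in H1; apply upair_inj in H2; intuition congruence.
Qed.

Lemma in_succ x z : z ∈ succ x <-> z ∈ x \/ z = x.
Proof.
  revert z; unfold succ, is_succ; apply the_ext_spec.
  exists (union2 x (upair x x)); intros z; rewrite in_union2, in_upair; tauto.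
Qed.

Lemma is_succE y x : is_succ y x <-> y = succ x.
Proof.
  split; [|intros ->; exact (in_succ x)].
  intros H; apply set_ext; intros z; now rewrite (H z), in_succ.
Qed.

Lemma in_prod A B p : p ∈ prod A B <-> exists x y, x ∈ A /\ y ∈ B /\ p = pair x y.
Proof.
  unfold prod; rewrite in_sep by exact _; split; [tauto|].
  intros H; split; [|exact H]. destruct H as (x & y & Hx & Hy & Hp).
  apply is_opairE in Hp. apply in_power; intros q Hq; apply in_power; intros z Hz.
  apply in_union2. apply Hp in Hq as [H|H]; apply H in Hz; intuition (subst; auto).
Qed.

Lemma pair_in_prod A B x y : pair x y ∈ prod A B <-> x ∈ A /\ y ∈ B.
Proof.
  rewrite in_prod; split.
  - intros (x' & y' & Hx & Hy & H); apply pair_inj in H as [-> ->]; auto.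
  - intros []; exists x, y; auto.
Qed.

Lemma valueE f x y : value f x y <-> pair x y ∈ f.
Proof.
  unfold value; split.
  - intros [p [H K]]; apply is_opairE in H; now subst.
  - intros H; exists (pair x y); split; [now apply is_opairE|exact H].
Qed.

Lemma iteT (P : Prop) x y : P -> ite P x y = x.
Proof. intros H; apply the_eq; tauto. Qed.
Lemma iteF (P : Prop) x y : ~ P -> ite P x y = y.
Proof. intros H; apply the_eq; tauto. Qed.

Lemma value_lam A (t : V -> V) x y : DTerm (fun e => t (e 0)) ->
  value (lam A t) x y <-> x ∈ A /\ y = t x.
Proof.
  intros H; rewrite valueE; unfold lam; rewrite in_image by exact _; split.
  - intros [z [Hz E]]; apply pair_inj in E as [-> ->]; auto.
  - intros [Hx ->]; exists x; auto.
Qed.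

Lemma is_fun_lam A B (t : V -> V) : DTerm (fun e => t (e 0)) ->
  (forall x, x ∈ A -> t x ∈ B) -> is_fun (lam A t) A B.
Proof.
  intros Ht H; split.
  - intros p; unfold lam; rewrite in_image by exact _; intros [x [Hx ->]].
    exists x, (t x); rewrite is_opairE; auto.
  - intros x Hx; exists (t x); split; [now apply value_lam|].
    intros y Hy; now apply value_lam in Hy.
Qed.

Lemma app_lam A (t : V -> V) x : DTerm (fun e => t (e 0)) -> x ∈ A -> app (lam A t) x = t x.
Proof.
  intros H Hx; apply the_eq; [now apply value_lam|].
  intros y Hy; now apply value_lam in Hy.
Qed.

Lemma app_eq f A B x y : is_fun f A B -> value f x y -> app f x = y.
Proof.
  intros [H1 H2] H. apply the_eq; [exact H|]. intros z Hz.
  assert (Hx : x ∈ A).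
  { apply valueE, H1 in H as (x' & y' & Hx & _ & E). apply is_opairE, pair_inj in E as [-> _]; exact Hx. }
  destruct (H2 x Hx) as [u [_ Hu]]. rewrite <- (Hu y H), <- (Hu z Hz); reflexivity.
Qed.

Lemma value_in f A B x y : is_fun f A B -> value f x y -> x ∈ A /\ y ∈ B.
Proof.
  intros [H _] K; apply valueE, H in K as (x' & y' & Hx & Hy & E).
  apply is_opairE, pair_inj in E as [-> ->]; auto.
Qed.

Lemma value_app f A B x : is_fun f A B -> x ∈ A -> value f x (app f x).
Proof.
  intros [_ H] Hx. apply (the_spec (fun y => value f x y)), H, Hx.
Qed.

Lemma app_in f A B x : is_fun f A B -> x ∈ A -> app f x ∈ B.
Proof. intros H Hx; exact (proj2 (value_in _ _ _ _ _ H (value_app _ _ _ _ H Hx))). Qed.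

Lemma is_fun_of_lam f A B : is_fun f A B -> f = lam A (app f).
Proof.
  intros H; apply set_ext; intros p. unfold lam; rewrite in_image by exact _; split.
  - intros Hp. destruct (proj1 H p Hp) as (x & y & Hx & Hy & E). apply is_opairE in E; subst p.
    exists x; split; [exact Hx|]. now rewrite (app_eq f A B x y H (proj2 (valueE _ _ _) Hp)).
  - intros [x [Hx ->]]. apply valueE. eapply value_app; eauto.
Qed.

(** * Natural numbers *)

Lemma is_nat_empty : is_nat empty.
Proof.
  intros w [[z [Hz Hw]] _]. apply is_emptyE in Hz; now subst.
Qed.

Lemma is_nat_succ n : is_nat n -> is_nat (succ n).
Proof.
  intros H w Hw. destruct (proj2 Hw n (H w Hw)) as [y [Hy Hyw]].
  apply is_succE in Hy; now subst.
Qed.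

Lemma in_omega n : n ∈ omega <-> is_nat n.
Proof.
  revert n; unfold omega, is_omega; apply the_ext_spec.
  destruct (zf_infinity V hV) as [w Hw].
  exists (sep w is_nat); intros n; rewrite in_sep by exact _.
  split; [tauto|]. intros H; split; [exact (H w Hw)|exact H].
Qed.

Lemma nat_omega n : is_nat n -> n ∈ omega.
Proof. apply in_omega. Qed.

Lemma is_omegaE w : is_omega w <-> w = omega.
Proof.
  split; [|intros ->; exact in_omega].
  intros H; apply set_ext; intros z; now rewrite (H z), in_omega.
Qed.

Lemma value_nat f n y : value f n y -> is_fun f omega omega -> is_nat n.
Proof. intros H Hf; apply in_omega; exact (proj1 (value_in _ _ _ _ _ Hf H)). Qed.

(** Being a natural number quantifies over inductive sets of [V], so [P] must first be turned into a
    subset of ω by separation; hence the definability hypothesis. *)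
Lemma nat_ind (P : V -> Prop) : Definable (fun e => P (e 0)) -> P empty ->
  (forall n, is_nat n -> P n -> P (succ n)) -> forall n, is_nat n -> P n.
Proof.
  intros HD H0 HS n Hn.
  enough (n ∈ sep omega P) by (now apply in_sep in H).
  apply Hn; split.
  - exists empty; split; [exact not_in_empty|]. rewrite in_sep by exact _; split; [|exact H0].
    apply nat_omega, is_nat_empty.
  - intros x; rewrite in_sep by exact _; intros [Hx HP]; exists (succ x); split; [exact (in_succ x)|].
    rewrite in_sep by exact _. apply in_omega in Hx; split; [|auto].
    apply nat_omega, is_nat_succ, Hx.
Qed.

Lemma succ_neq_empty x : succ x <> empty.
Proof. intros H; apply (not_in_empty x); rewrite <- H; apply in_succ; auto. Qed.

Lemma succ_inj x y : succ x = succ y -> x = y.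
Proof.
  intros H.
  assert (K : forall z, z ∈ x \/ z = x <-> z ∈ y \/ z = y) by (intros; rewrite <- !in_succ, H; reflexivity).
  destruct (proj1 (K x) (or_intror eq_refl)) as [Hx|]; [|auto].
  destruct (proj2 (K y) (or_intror eq_refl)) as [Hy|]; [|auto].
  (* What remains is [x ∈ y] and [y ∈ x], and then the set of these two has no ∈-minimal element. *)
  destruct (zf_foundation V hV (upair x y)) as [u [Hu Hd]].
  { exists x; apply in_upair; auto. }
  apply in_upair in Hu as [-> | ->]; exfalso.
  - apply (Hd y); rewrite in_upair; auto.
  - apply (Hd x); rewrite in_upair; auto.
Qed.

Section Recursion.
Variables (a : V) (step : V -> V).
Hypothesis a_nat : is_nat a.
Hypothesis step_nat : forall y, is_nat y -> is_nat (step y).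
Hypothesis dterm_step : forall u, DTerm u -> DTerm (fun e => step (u e)).

(* The least relation containing [(0, a)] and closed under
   [(n, y) |-> (n + 1, step y)]. *)
Let graph := sep (prod omega omega) (fun p => forall R,
  (pair empty a ∈ R /\ forall n y, n ∈ omega -> y ∈ omega ->
     pair n y ∈ R -> pair (succ n) (step y) ∈ R) -> p ∈ R).

Lemma recursion : exists f, is_fun f omega omega /\ app f empty = a /\
  forall n, is_nat n -> app f (succ n) = step (app f n).
Proof.
  assert (Hin : forall p, p ∈ graph <-> p ∈ prod omega omega /\ (forall R,
  (pair empty a ∈ R /\ forall n y, n ∈ omega -> y ∈ omega ->
     pair n y ∈ R -> pair (succ n) (step y) ∈ R) -> p ∈ R)).
  { intros p; unfold graph; apply in_sep; exact _. }
  assert (G0 : pair empty a ∈ graph).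
  { apply Hin; split; [|tauto]. apply pair_in_prod; rewrite !in_omega; auto using is_nat_empty. }
  assert (GS : forall n y, pair n y ∈ graph -> pair (succ n) (step y) ∈ graph).
  { intros n y; rewrite !Hin; intros [H K].
    apply pair_in_prod in H as [Hn Hy]. split.
    - apply pair_in_prod; rewrite in_omega in *; rewrite in_omega; auto using is_nat_succ.
    - intros R HR; apply HR; [exact Hn|exact Hy|apply K, HR]. }
  assert (Gmin : forall q, q ∈ graph -> q = pair empty a \/
     exists n y, pair n y ∈ graph /\ q = pair (succ n) (step y)).
  { intros q Hq.
    apply NNPP; intros Hc.
    (* If [q] had neither form, deleting it from [graph] would leave a set with the same closure
       properties, against minimality. *)
    assert (K : q ∈ sep graph (fun p => p <> q)).
    { apply Hin; [exact Hq|]. split.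
      - rewrite in_sep by exact _. split; [exact G0|]. intros <-; tauto.
      - intros n y Hn Hy. rewrite !in_sep by exact _; intros [H1 _]. split; [now apply GS|].
        intros <-. apply Hc; eauto. }
    rewrite in_sep in K by exact _; tauto. }
  assert (Hf : is_fun graph omega omega).
  { split.
    - intros p Hp. apply Hin in Hp as [Hp _]. apply in_prod in Hp as (x & y & Hx & Hy & ->).
      exists x, y; rewrite is_opairE; auto.
    - intros n Hn. apply in_omega in Hn; revert n Hn. apply nat_ind; [exact _| |].
      + exists a; split; [now apply valueE|]. intros y Hy.
        apply valueE, Gmin in Hy as [H|(n & z & _ & H)]; apply pair_inj in H as [H1 H2]; [auto|].
        symmetry in H1; now apply succ_neq_empty in H1.
      + intros n Hn [y [Hy Hu]]. exists (step y); split; [apply valueE; now apply GS, valueE|].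
        intros z Hz. apply valueE, Gmin in Hz as [H|(m & u & K & H)]; apply pair_inj in H as [H1 H2].
        * now apply succ_neq_empty in H1.
        * apply succ_inj in H1; subst m z. f_equal. apply Hu. now apply valueE. }
  exists graph; split; [exact Hf|]; split.
  - eapply app_eq; [exact Hf|]. now apply valueE.
  - intros n Hn. eapply app_eq; [exact Hf|]. apply valueE, GS, valueE.
    eapply value_app; [exact Hf|]. now apply nat_omega.
Qed.
End Recursion.

(** * Addition, multiplication and order on ω *)

Definition add (m n : V) : V := the (fun k => nat_add m n k).
#[export] Instance dterm_add (t u : (nat -> V) -> V) :
  DTerm t -> DTerm u -> DTerm (fun e => add (t e) (u e)).
Proof. unfold add; exact _. Qed.

Definition mul (m n : V) : V := the (fun k => nat_mul m n k).
#[export] Instance dterm_mul (t u : (nat -> V) -> V) :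
  DTerm t -> DTerm u -> DTerm (fun e => mul (t e) (u e)).
Proof. unfold mul; exact _. Qed.

Lemma nat_add_fun m : is_nat m -> exists f, is_fun f omega omega /\ app f empty = m /\
  (forall n, is_nat n -> app f (succ n) = succ (app f n)) /\
  forall n k, nat_add m n k <-> is_nat n /\ k = app f n.
Proof.
  intros Hm.
  destruct (recursion m succ Hm is_nat_succ _) as (f & Hf & H0 & HS).
  exists f; repeat (split; [assumption|]). intros n k; split.
  - intros (w & g & Hw & Hg & G0 & GS & Gn). apply is_omegaE in Hw; subst w.
    assert (E : forall n, is_nat n -> app g n = app f n).
    { apply nat_ind; [exact _| |].
      - rewrite H0; eapply app_eq; [exact Hg|]. apply G0, is_emptyE, eq_refl.
      - intros i Hi IH; rewrite HS, <- IH by exact Hi. eapply app_eq; [exact Hg|].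
        eapply (GS i); [eapply value_app; [exact Hg|now apply nat_omega]| |]; now apply is_succE. }
    pose proof (value_nat _ _ _ Gn Hg) as Hn.
    split; [exact Hn|]. rewrite <- E by exact Hn. symmetry; eapply app_eq; eauto.
  - intros [Hn ->]. exists omega, f; split; [now apply is_omegaE|]. split; [exact Hf|].
    assert (Hv : forall n, is_nat n -> value f n (app f n))
      by (intros; eapply value_app; [exact Hf|now apply nat_omega]).
    split; [|split; [|auto]].
    + intros z Hz; apply is_emptyE in Hz; subst. apply Hv, is_nat_empty.
    + intros i i' j j' Hi Hi' Hj'. apply is_succE in Hi', Hj'; subst.
      pose proof (value_nat _ _ _ Hi Hf) as Hin.
      rewrite <- (app_eq _ _ _ _ _ Hf Hi), <- HS by assumption. apply Hv; auto using is_nat_succ.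
Qed.

Lemma nat_add_nat m n k : nat_add m n k -> is_nat m /\ is_nat n /\ is_nat k.
Proof.
  intros (w & g & Hw & Hg & G0 & _ & Gn). apply is_omegaE in Hw; subst w.
  rewrite <- !in_omega. apply (value_in _ _ _ _ _ Hg) in Gn.
  specialize (G0 empty (proj2 (is_emptyE _) eq_refl)). apply (value_in _ _ _ _ _ Hg) in G0. tauto.
Qed.

Lemma add_props m : is_nat m -> add m empty = m /\
  forall n, is_nat n -> add m (succ n) = succ (add m n) /\ forall k, nat_add m n k <-> k = add m n.
Proof.
  intros Hm; destruct (nat_add_fun m Hm) as (f & Hf & H0 & HS & K).
  assert (E : forall n, is_nat n -> add m n = app f n).
  { intros n Hn; apply the_eq; [now apply K|]. intros k Hk; now apply K in Hk. }
  split; [rewrite E by exact is_nat_empty; exact H0|].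
  intros n Hn. rewrite !E by auto using is_nat_succ. split; [now apply HS|].
  intros k; rewrite K; tauto.
Qed.

Lemma add_0_r m : is_nat m -> add m empty = m.
Proof. intros H; apply add_props, H. Qed.

Lemma add_S_r m n : is_nat m -> is_nat n -> add m (succ n) = succ (add m n).
Proof. intros H K; apply add_props; assumption. Qed.

Lemma nat_addE m n k : nat_add m n k <-> is_nat m /\ is_nat n /\ k = add m n.
Proof.
  split.
  - intros H; destruct (nat_add_nat _ _ _ H) as (Hm & Hn & _).
    split; [exact Hm|split; [exact Hn|]]. now apply (add_props m Hm).
  - intros (Hm & Hn & ->). now apply (add_props m Hm).
Qed.

Lemma is_nat_add m n : is_nat m -> is_nat n -> is_nat (add m n).
Proof. intros Hm Hn. apply (nat_add_nat m n). now apply nat_addE. Qed.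

Lemma nat_mul_fun m : is_nat m -> exists f, is_fun f omega omega /\ app f empty = empty /\
  (forall n, is_nat n -> app f (succ n) = add (app f n) m) /\
  forall n k, nat_mul m n k <-> is_nat n /\ k = app f n.
Proof.
  intros Hm.
  destruct (recursion empty (fun y => add y m) is_nat_empty
    (fun y H => is_nat_add y m H Hm) _) as (f & Hf & H0 & HS).
  exists f; repeat (split; [assumption|]). intros n k; split.
  - intros (_ & w & g & Hw & Hg & G0 & GS & Gn). apply is_omegaE in Hw; subst w.
    assert (E : forall n, is_nat n -> app g n = app f n).
    { apply nat_ind; [exact _| |].
      - rewrite H0; eapply app_eq; [exact Hg|]. apply G0, is_emptyE, eq_refl.
      - intros i Hi IH; rewrite HS, <- IH by exact Hi. eapply app_eq; [exact Hg|].
        assert (i ∈ omega) by now apply nat_omega.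
        eapply (GS i); [eapply value_app; [exact Hg|assumption]|now apply is_succE|].
        apply nat_addE; split; [|auto]. apply in_omega; eapply app_in; eauto. }
    pose proof (value_nat _ _ _ Gn Hg) as Hn.
    split; [exact Hn|]. rewrite <- E by exact Hn. symmetry; eapply app_eq; eauto.
  - intros [Hn ->]. split; [exact Hm|].
    exists omega, f; split; [now apply is_omegaE|]. split; [exact Hf|].
    assert (Hv : forall n, is_nat n -> value f n (app f n))
      by (intros; eapply value_app; [exact Hf|now apply nat_omega]).
    split; [|split; [|auto]].
    + intros z Hz; apply is_emptyE in Hz; subst. rewrite <- H0 at 2. apply Hv, is_nat_empty.
    + intros i i' j j' Hi Hi' Hj'. apply is_succE in Hi'; apply nat_addE in Hj'; subst.
      destruct Hj' as (_ & _ & ->).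
      pose proof (value_nat _ _ _ Hi Hf) as Hin.
      rewrite <- (app_eq _ _ _ _ _ Hf Hi), <- HS by assumption. apply Hv; auto using is_nat_succ.
Qed.

Lemma nat_mul_nat m n k : nat_mul m n k -> is_nat m /\ is_nat n /\ is_nat k.
Proof.
  intros (Hm & w & g & Hw & Hg & _ & _ & Gn). apply is_omegaE in Hw; subst w.
  split; [exact Hm|]. rewrite <- !in_omega. now apply (value_in _ _ _ _ _ Hg) in Gn.
Qed.

Lemma mul_props m : is_nat m -> mul m empty = empty /\
  forall n, is_nat n -> mul m (succ n) = add (mul m n) m /\ forall k, nat_mul m n k <-> k = mul m n.
Proof.
  intros Hm; destruct (nat_mul_fun m Hm) as (f & Hf & H0 & HS & K).
  assert (E : forall n, is_nat n -> mul m n = app f n).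
  { intros n Hn; apply the_eq; [now apply K|]. intros k Hk; now apply K in Hk. }
  split; [rewrite E by exact is_nat_empty; exact H0|].
  intros n Hn. rewrite !E by auto using is_nat_succ. split; [now apply HS|].
  intros k; rewrite K; tauto.
Qed.

Lemma mul_0_r m : is_nat m -> mul m empty = empty.
Proof. intros H; apply mul_props, H. Qed.

Lemma mul_S_r m n : is_nat m -> is_nat n -> mul m (succ n) = add (mul m n) m.
Proof. intros H K; apply mul_props; assumption. Qed.

Lemma nat_mulE m n k : nat_mul m n k <-> is_nat m /\ is_nat n /\ k = mul m n.
Proof.
  split.
  - intros H; destruct (nat_mul_nat _ _ _ H) as (Hm & Hn & _).
    split; [exact Hm|split; [exact Hn|]]. now apply (mul_props m Hm).
  - intros (Hm & Hn & ->). now apply (mul_props m Hm).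
Qed.

Lemma is_nat_mul m n : is_nat m -> is_nat n -> is_nat (mul m n).
Proof. intros Hm Hn. apply (nat_mul_nat m n). now apply nat_mulE. Qed.

#[local] Hint Resolve is_nat_empty is_nat_succ is_nat_add is_nat_mul : core.

Ltac induct n := match goal with H : is_nat n |- _ => revert n H end;
  match goal with |- forall n, is_nat n -> @?P n => apply (nat_ind P); [exact _| |] end.
Ltac nsimp := repeat (rewrite add_0_r || rewrite add_S_r || rewrite mul_0_r || rewrite mul_S_r); auto.

Lemma add_0_l n : is_nat n -> add empty n = n.
Proof. intros; induct n; nsimp. intros; nsimp; congruence. Qed.

Lemma add_S_l m n : is_nat m -> is_nat n -> add (succ m) n = succ (add m n).
Proof. intros; induct n; nsimp. intros; nsimp; congruence. Qed.

Lemma add_comm m n : is_nat m -> is_nat n -> add m n = add n m.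
Proof.
  intros; induct n; nsimp; [now rewrite add_0_l|].
  intros; nsimp. rewrite add_S_l; congruence || auto.
Qed.

Lemma add_assoc k m n : is_nat k -> is_nat m -> is_nat n -> add k (add m n) = add (add k m) n.
Proof. intros; induct n; nsimp. intros; nsimp; congruence. Qed.

Lemma mul_0_l n : is_nat n -> mul empty n = empty.
Proof. intros; induct n; nsimp. intros; nsimp; congruence. Qed.

Lemma mul_S_l m n : is_nat m -> is_nat n -> mul (succ m) n = add (mul m n) n.
Proof.
  intros; induct n; nsimp. intros n Hn E; nsimp.
  rewrite E, <- !add_assoc, (add_comm m) by auto; reflexivity.
Qed.

Lemma mul_comm m n : is_nat m -> is_nat n -> mul m n = mul n m.
Proof.
  intros; induct n; nsimp; [now rewrite mul_0_l|].
  intros; nsimp. rewrite mul_S_l; congruence || auto.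
Qed.

Lemma mul_add_l k m n : is_nat k -> is_nat m -> is_nat n ->
  mul (add k m) n = add (mul k n) (mul m n).
Proof.
  intros; induct n; nsimp. intros n Hn E; nsimp.
  rewrite E, !add_assoc by auto; f_equal.
  rewrite <- !add_assoc by auto; f_equal; apply add_comm; auto.
Qed.

Lemma mul_assoc k m n : is_nat k -> is_nat m -> is_nat n -> mul k (mul m n) = mul (mul k m) n.
Proof.
  intros; induct n; nsimp. intros n Hn E; nsimp.
  rewrite <- E, (mul_comm k (add _ _)), mul_add_l, (mul_comm _ k), (mul_comm m k) by auto; reflexivity.
Qed.

Lemma add_cancel_r k m n : is_nat k -> is_nat m -> is_nat n -> add k n = add m n -> k = m.
Proof.
  intros; revert H2; induct n; nsimp. intros n Hn E; nsimp. intros H3; apply E, succ_inj, H3.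
Qed.

(** Membership is replaced by an additive witness, after which inequalities can be proved by
    algebraic identities. *)
Lemma in_nat_iff m n : is_nat m -> is_nat n ->
  (m ∈ n <-> exists k, is_nat k /\ n = add m (succ k)).
Proof.
  intros; induct n.
  - split; [intros []%not_in_empty|]. intros (k & Hk & E). revert E; nsimp.
    intros E; symmetry in E; now apply succ_neq_empty in E.
  - intros n Hn IH. rewrite in_succ, IH; split.
    + intros [(k & Hk & ->)| ->].
      * exists (succ k); nsimp.
      * exists empty; nsimp.
    + intros (k & Hk & E); revert E; nsimp; intros E; apply succ_inj in E; subst n.
      destruct (classic (k = empty)) as [->|Hk0]; [right; nsimp|left].
      clear IH Hn. revert Hk0; induct k; [tauto|]. intros k Hk _ _; exists k; nsimp.
Qed.

Lemma nat_total m n : is_nat m -> is_nat n -> m ∈ n \/ m = n \/ n ∈ m.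
Proof.
  intros Hm Hn0; induct n.
  - induct m; [auto|]. intros m Hm [[]%not_in_empty|[->|K]]; right; right; apply in_succ; auto.
  - intros n Hn [K|[->|K]]; rewrite !in_succ; auto.
    apply in_nat_iff in K as (k & Hk & ->); [|auto|auto].
    destruct (classic (k = empty)) as [->|Hk0]; [right; left; nsimp|right; right].
    clear Hm. revert Hk0; induct k; [tauto|]. intros k Hk _ _.
    apply in_nat_iff; auto. exists k; nsimp. rewrite add_S_l; auto.
Qed.

End Arithmetic.

(** * Semiring of natural numbers *)

Section Reals.
Context {V : set_structure} {hV : ZF V}.

(** ω of [V] may be nonstandard, so it cannot be identified with [nat]. Bundling its elements with
    [is_nat] makes the semiring laws unconditional, as [ring] requires. *)
Definition whole : Type := {n : V | is_nat n}.
Definition val (n : whole) : V := proj1_sig n.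

Lemma val_nat n : is_nat (val n).
Proof. exact (proj2_sig n). Qed.

Lemma val_inj m n : val m = val n -> m = n.
Proof. apply eq_sig_hprop; intros; apply proof_irrelevance. Qed.

Lemma whole_of n : is_nat n -> exists m : whole, n = val m.
Proof. intros H; exists (exist _ n H); reflexivity. Qed.

Definition w0 : whole := exist _ empty is_nat_empty.
Definition w1 : whole := exist _ (succ empty) (is_nat_succ _ is_nat_empty).
Definition wadd (m n : whole) : whole :=
  exist _ (add (val m) (val n)) (is_nat_add _ _ (val_nat m) (val_nat n)).
Definition wmul (m n : whole) : whole :=
  exist _ (mul (val m) (val n)) (is_nat_mul _ _ (val_nat m) (val_nat n)).

Declare Scope whole_scope.
Bind Scope whole_scope with whole.
Delimit Scope whole_scope with W.
Local Open Scope whole_scope.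
Notation "0" := w0 : whole_scope.
Notation "1" := w1 : whole_scope.
Infix "+" := wadd : whole_scope.
Infix "*" := wmul : whole_scope.
Definition wle (m n : whole) := exists k, n = m + k.
Definition wlt (m n : whole) := exists k, n = m + k + 1.
Infix "<=" := wle : whole_scope.
Infix "<" := wlt : whole_scope.

Lemma whole_semi_ring : semi_ring_theory 0 1 wadd wmul eq.
Proof.
  split; intros; apply val_inj; simpl;
    repeat match goal with n : whole |- _ =>
      let a := fresh "a" in let Ha := fresh "Ha" in destruct n as [a Ha]; simpl end.
  - now apply add_0_l.
  - now apply add_comm.
  - now apply add_assoc.
  - rewrite mul_S_l, mul_0_l, add_0_l; auto using is_nat_empty.
  - now apply mul_0_l.
  - now apply mul_comm.
  - now apply mul_assoc.
  - now apply mul_add_l.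
Qed.
Add Ring whole_ring : whole_semi_ring.

Lemma val_add m n : val (m + n) = add (val m) (val n).
Proof. reflexivity. Qed.
Lemma val_mul m n : val (m * n) = mul (val m) (val n).
Proof. reflexivity. Qed.
Lemma val_succ m : succ (val m) = val (m + 1).
Proof.
  rewrite val_add; simpl. rewrite add_S_r, add_0_r; auto using is_nat_empty, val_nat.
Qed.

Lemma val_lt m n : val m ∈ val n <-> m < n.
Proof.
  rewrite in_nat_iff by apply val_nat; split.
  - intros (k & Hk & E). destruct (whole_of k Hk) as [k' ->]. exists k'.
    apply val_inj; rewrite E, val_succ. rewrite <- val_add. f_equal; ring.
  - intros [k ->]. exists (val k); split; [apply val_nat|].
    rewrite val_succ, <- val_add. f_equal; ring.
Qed.

Lemma wadd_cancel a b c : a + c = b + c -> a = b.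
Proof.
  intros H. apply val_inj, (add_cancel_r (val a) (val b) (val c)); try apply val_nat.
  now rewrite <- !val_add, H.
Qed.

Lemma w_neq_S a : a + 1 <> 0.
Proof. intros H. apply (f_equal val) in H. rewrite <- val_succ in H. now apply succ_neq_empty in H. Qed.

Lemma wlt_or_wle a b : a < b \/ b <= a.
Proof.
  destruct (nat_total (val a) (val b) (val_nat a) (val_nat b)) as [H|[H|H]].
  - left; now apply val_lt.
  - right; exists 0. apply val_inj in H; subst; ring.
  - right; apply val_lt in H as [k ->]; exists (k + 1); ring.
Qed.

Lemma w_pos c : c <> 0 -> exists k, c = k + 1.
Proof.
  intros H; destruct (nat_total (val 0) (val c) (val_nat 0) (val_nat c)) as [K|[K|K]].
  - apply val_lt in K as [k ->]; exists k; ring.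
  - apply val_inj in K; congruence.
  - now apply not_in_empty in K.
Qed.

Lemma w_mul_neq a b : a <> 0 -> b <> 0 -> a * b <> 0.
Proof.
  intros [k ->]%w_pos [j ->]%w_pos H.
  apply (w_neq_S (k * j + k + j)); rewrite <- H; ring.
Qed.

(* [c1 (v1 - u1) + c2 (v2 - u2) + s = y (R - L)], written without subtraction. *)
Lemma wlt_cert y c1 c2 s u1 v1 u2 v2 L R :
  u1 < v1 -> u2 <= v2 -> c1 <> 0 ->
  y * L + c1 * v1 + c2 * v2 + s = y * R + c1 * u1 + c2 * u2 -> L < R.
Proof.
  intros [k ->] [m ->] [c ->]%w_pos E.
  destruct (wlt_or_wle L R) as [H|[j ->]]; [exact H|exfalso].
  apply (w_neq_S (c * k + c + k + c2 * m + s + y * j)).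
  apply (wadd_cancel _ _ (y * R + (c + 1) * u1 + c2 * u2)).
  etransitivity; [|etransitivity; [exact E|ring]]; ring.
Qed.

(** A Farkas certificate: the caller names the multipliers and the slack [s], [ring] checks the
    identity, and only [c1 <> 0] is left to prove. *)
Ltac cert y c1 c2 s H1 H2 := apply (wlt_cert y c1 c2 s _ _ _ _ _ _ H1 H2); [|ring].

Lemma w1_neq : 1 <> 0.
Proof. intros H; apply (f_equal val) in H. now apply succ_neq_empty in H. Qed.

Lemma wlt_irrefl a : ~ a < a.
Proof.
  intros [k E]. apply (w_neq_S k), (wadd_cancel _ _ a).
  etransitivity; [|etransitivity; [symmetry; exact E|ring]]; ring.
Qed.

Lemma wlt_wle a b : a < b -> a <= b.
Proof. intros [k ->]; exists (k + 1); ring. Qed.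

Lemma wle_antisym a b : a <= b -> b <= a -> a = b.
Proof.
  intros H [j E]. destruct (classic (j = 0)) as [->|[k ->]%w_pos]; [rewrite E; ring|].
  exfalso. apply (wlt_irrefl a). assert (K : b < a) by (exists k; rewrite E; ring).
  cert 1 1 1 0 K H. exact w1_neq.
Qed.

Lemma wle_refl a : a <= a.
Proof. exists 0; ring. Qed.

(** * Fractions *)

Definition mk (a b c : whole) : V := pair (pair (val a) (val b)) (val c).

Lemma mk_inj a b c a' b' c' : mk a b c = mk a' b' c' -> a = a' /\ b = b' /\ c = c'.
Proof.
  intros H; apply pair_inj in H as [H Hc]; apply pair_inj in H as [Ha Hb].
  auto using val_inj.
Qed.

Lemma fracE q a b c : frac q (val a) (val b) (val c) <-> c <> 0 /\ q = mk a b c.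
Proof.
  unfold frac; split.
  - intros (_ & _ & _ & Hc & p & Hp & Hq). apply is_opairE in Hp; apply is_opairE in Hq; subst.
    split; [|reflexivity]. intros ->. now apply Hc, is_emptyE.
  - intros [Hc ->]; repeat (split; [apply val_nat|]). split.
    + intros H; apply is_emptyE in H. apply Hc, val_inj, H.
    + exists (pair (val a) (val b)); split; now apply is_opairE.
Qed.

Lemma frac_whole (q a b c : V) : frac q a b c ->
  exists a' b' c' : whole, a = val a' /\ b = val b' /\ c = val c'.
Proof.
  intros (Ha & Hb & Hc & _).
  destruct (whole_of a Ha) as [a' ->], (whole_of b Hb) as [b' ->], (whole_of c Hc) as [c' ->].
  exists a', b', c'; auto.
Qed.

Lemma is_fracE (q : V) : is_frac q <-> exists a b c, c <> 0 /\ q = mk a b c.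
Proof.
  split.
  - intros (a & b & c & H). destruct (frac_whole _ _ _ _ H) as (a' & b' & c' & -> & -> & ->).
    exists a', b', c'; now apply fracE.
  - intros (a & b & c & H); exists (val a), (val b), (val c); now apply fracE.
Qed.

Lemma nat_linE a b c d k :
  nat_lin (val a) (val b) (val c) (val d) k <-> k = val (a * b + c * d).
Proof.
  unfold nat_lin; split.
  - intros (x & y & Hx & Hy & Hk). apply nat_mulE in Hx, Hy; apply nat_addE in Hk.
    destruct Hx as (_ & _ & ->), Hy as (_ & _ & ->), Hk as (_ & _ & ->); reflexivity.
  - intros ->; exists (val (a * b)), (val (c * d)).
    rewrite !nat_mulE, nat_addE; auto using val_nat.
Qed.

Lemma frac_lt_inv (q q' : V) : frac_lt q q' -> exists a b c a' b' c',
  c <> 0 /\ c' <> 0 /\ q = mk a b c /\ q' = mk a' b' c' /\ a * c' + b' * c < a' * c + b * c'.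
Proof.
  intros (a & b & c & a' & b' & c' & l & r & H & H' & Hl & Hr & Hlr).
  destruct (frac_whole _ _ _ _ H) as (a1 & b1 & c1 & -> & -> & ->).
  destruct (frac_whole _ _ _ _ H') as (a2 & b2 & c2 & -> & -> & ->).
  apply nat_linE in Hl, Hr; subst l r; apply val_lt in Hlr.
  apply fracE in H as [Hc ->], H' as [Hc' ->].
  exists a1, b1, c1, a2, b2, c2; auto.
Qed.

Lemma frac_lt_intro a b c a' b' c' : c <> 0 -> c' <> 0 ->
  a * c' + b' * c < a' * c + b * c' -> frac_lt (mk a b c) (mk a' b' c').
Proof.
  intros Hc Hc' H.
  exists (val a), (val b), (val c), (val a'), (val b'), (val c'),
   (val (a * c' + b' * c)), (val (a' * c + b * c')).
  now rewrite !fracE, !nat_linE, val_lt.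
Qed.

Lemma frac_addE (q q' s : V) : frac_add q q' s <-> exists a b c a' b' c',
  c <> 0 /\ c' <> 0 /\ q = mk a b c /\ q' = mk a' b' c' /\
  s = mk (a * c' + a' * c) (b * c' + b' * c) (c * c').
Proof.
  split.
  - intros (a & b & c & a' & b' & c' & a'' & b'' & c'' & H & H' & H'' & Ha & Hb & Hc).
    destruct (frac_whole _ _ _ _ H) as (a1 & b1 & c1 & -> & -> & ->).
    destruct (frac_whole _ _ _ _ H') as (a2 & b2 & c2 & -> & -> & ->).
    apply nat_linE in Ha, Hb; apply nat_mulE in Hc as (_ & _ & Hc); subst.
    change (mul (val c1) (val c2)) with (val (c1 * c2)) in H''.
    apply fracE in H as [Hc ->], H' as [Hc' ->], H'' as [_ ->].
    exists a1, b1, c1, a2, b2, c2; auto.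
  - intros (a & b & c & a' & b' & c' & Hc & Hc' & -> & -> & ->).
    exists (val a), (val b), (val c), (val a'), (val b'), (val c'),
      (val (a * c' + a' * c)), (val (b * c' + b' * c)), (val (c * c')).
    rewrite !fracE, !nat_linE, nat_mulE.
    repeat split; auto using val_nat, w_mul_neq.
Qed.

Lemma frac_add_comm (q q' s : V) : frac_add q q' s -> frac_add q' q s.
Proof.
  rewrite !frac_addE; intros (a & b & c & a' & b' & c' & Hc & Hc' & -> & -> & ->).
  exists a', b', c', a, b, c; repeat (split; [assumption || reflexivity|]).
  f_equal; ring.
Qed.

Lemma real_add_comm (r s t : V) : real_add r s t -> real_add s r t.
Proof.
  intros H q; rewrite (H q); split; intros (x & y & z & Hx & Hy & Hz & Hq);
    exists y, x, z; auto using frac_add_comm.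
Qed.

Definition fractions : V := sep (prod (prod omega omega) omega) is_frac.

Lemma in_fractions q : q ∈ fractions <-> is_frac q.
Proof.
  unfold fractions; rewrite in_sep by exact _; split; [tauto|].
  intros H; split; [|exact H]. apply is_fracE in H as (a & b & c & _ & ->).
  unfold mk; rewrite !pair_in_prod. auto using nat_omega, val_nat.
Qed.

(** * Cuts at natural numbers *)

(** The real number [n], with [(a - b) / c < n] cleared of subtraction and denominator. The argument
    is a set, not a [whole], so that cuts may occur in formulas. *)
Definition cut (n : V) : V :=
  sep fractions (fun q => exists a b c, frac q a b c /\ a ∈ add b (mul n c)).

#[export] Instance dterm_cut t : DTerm t -> DTerm (fun e => cut (t e)).
Proof. intros H; unfold cut; exact _. Qed.

Lemma in_cut q (n : whole) : q ∈ cut (val n) <->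
  exists a b c, c <> 0 /\ q = mk a b c /\ a < b + n * c.
Proof.
  unfold cut; rewrite in_sep by exact _. split.
  - intros [_ (a & b & c & H & K)].
    destruct (frac_whole _ _ _ _ H) as (a1 & b1 & c1 & -> & -> & ->).
    apply fracE in H as [Hc ->]. exists a1, b1, c1.
    rewrite <- val_mul, <- val_add, val_lt in K. auto.
  - intros (a & b & c & Hc & -> & K). split.
    + apply in_fractions, is_fracE; eauto.
    + exists (val a), (val b), (val c). rewrite fracE, <- val_mul, <- val_add, val_lt. auto.
Qed.

Lemma mk_in_cut a b c n : c <> 0 -> (mk a b c ∈ cut (val n) <-> a < b + n * c).
Proof.
  intros Hc; rewrite in_cut; split; [|eauto 7].
  intros (a' & b' & c' & _ & E & H). apply mk_inj in E as (-> & -> & ->). exact H.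
Qed.

Lemma cut_down (n : whole) q q' : q ∈ cut (val n) -> frac_lt q' q -> q' ∈ cut (val n).
Proof.
  rewrite in_cut; intros (a & b & c & Hc & -> & H) Hq.
  apply frac_lt_inv in Hq as (a1 & b1 & c1 & a2 & b2 & c2 & Hc1 & Hc2 & -> & E & K).
  apply mk_inj in E as (-> & -> & ->).
  apply mk_in_cut; [exact Hc1|].
  cert c2 1 c1 0 K (wlt_wle _ _ H). exact w1_neq.
Qed.

Lemma ext_real_cut (n : whole) : ext_real (cut (val n)).
Proof.
  split; [|split].
  - intros q Hq; apply in_cut in Hq as (a & b & c & Hc & -> & _); apply is_fracE; eauto.
  - intros q q'; apply cut_down.
  - intros q Hq; apply in_cut in Hq as (a & b & c & Hc & -> & H).
    assert (Hc2 : c * (1 + 1) <> 0) by (apply w_mul_neq; [exact Hc|apply w_neq_S]).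
    (* The midpoint of the given fraction and [n]. *)
    exists (mk (a + n * c) b (c * (1 + 1))); split.
    + apply mk_in_cut; [exact Hc2|]. cert 1 1 0 0 H (wle_refl 0). exact w1_neq.
    + apply frac_lt_intro; [exact Hc|exact Hc2|]. cert 1 c 0 0 H (wle_refl 0). exact Hc.
Qed.

Lemma unit_in_cut m n : mk m 0 1 ∈ cut (val n) <-> m < n.
Proof.
  rewrite mk_in_cut by exact w1_neq. replace (0 + n * 1) with n by ring. reflexivity.
Qed.

Lemma is_real_cut (n : whole) : is_real (cut (val n)).
Proof.
  split; [apply ext_real_cut|]. split.
  - exists (mk 0 1 1). apply mk_in_cut; [exact w1_neq|]. exists n; ring.
  - exists (mk n 0 1). rewrite unit_in_cut. split; [|apply wlt_irrefl].
    apply is_fracE; exists n, 0, 1; auto using w1_neq.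
Qed.

Lemma is_zeroE z : is_zero z <-> z = cut (val 0).
Proof.
  assert (K : forall q, q ∈ cut (val 0) <-> exists a b c, frac q a b c /\ a ∈ b).
  { intros q; rewrite in_cut; split.
    - intros (a & b & c & Hc & -> & H). exists (val a), (val b), (val c).
      rewrite fracE, val_lt. replace (b + 0 * c) with b in H by ring. auto.
    - intros (a & b & c & H & L).
      destruct (frac_whole _ _ _ _ H) as (a1 & b1 & c1 & -> & -> & ->).
      apply fracE in H as [Hc ->]; apply val_lt in L. exists a1, b1, c1.
      replace (b1 + 0 * c1) with b1 by ring. auto. }
  split; [|intros ->; exact K].
  intros H; apply set_ext; intros q. now rewrite (H q), K.
Qed.

Lemma cut_mono m n : m <= n -> subset (cut (val m)) (cut (val n)).
Proof.
  intros [k ->] q; rewrite !in_cut; intros (a & b & c & Hc & -> & H).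
  exists a, b, c; repeat (split; [assumption || reflexivity|]).
  cert 1 1 0 (k * c) H (wle_refl 0). exact w1_neq.
Qed.

(** If [n < m], the fraction [n/1] lies in the cut at [m] but not in the one at [n]. *)
Lemma cut_le_inv m n : subset (cut (val m)) (cut (val n)) -> m <= n.
Proof.
  intros H. destruct (wlt_or_wle n m) as [K|K]; [|exact K].
  apply unit_in_cut, H, unit_in_cut, wlt_irrefl in K as [].
Qed.

Lemma cut_inj m n : cut (val m) = cut (val n) -> m = n.
Proof.
  intros H; apply wle_antisym; apply cut_le_inv; rewrite H; exact (fun q K => K).
Qed.

Lemma is_nonneg_cut n : is_nonneg (cut (val n)).
Proof.
  split; [apply is_real_cut|]. exists (cut (val 0)); split; [now apply is_zeroE|].
  apply cut_mono; exists n; ring.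
Qed.

Lemma is_pos_cut n : 0 < n -> is_pos (cut (val n)).
Proof.
  intros H; split; [apply is_real_cut|]. exists (cut (val 0)); split; [now apply is_zeroE|].
  split.
  - apply cut_mono; exists n; ring.
  - intros E; apply cut_inj in E; subst. now apply wlt_irrefl in H.
Qed.

(** The Archimedean property: the missing fraction [(a0 - b0) / c0] is below [a0 + 1], so a fraction
    of [r] at or above [a0 + 1] would force the missing one into [r]. *)
Lemma ext_real_bounded r q : ext_real r -> is_frac q -> q ∉ r ->
  exists n, subset r (cut (val n)).
Proof.
  intros (Hr & Hdown & _) Hq Hnr. apply is_fracE in Hq as (a0 & b0 & c0 & Hc0 & ->).
  exists (a0 + 1). intros q Hq.
  destruct (proj1 (is_fracE q) (Hr q Hq)) as (a & b & c & Hc & ->).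
  apply mk_in_cut; [exact Hc|].
  destruct (wlt_or_wle a (b + (a0 + 1) * c)) as [H|H]; [exact H|exfalso].
  apply Hnr, (Hdown _ _ Hq), frac_lt_intro; [exact Hc0|exact Hc|].
  destruct (w_pos _ Hc0) as [k ->].
  (* [H] is a weak inequality; the strict one that [cert] demands is supplied by [0 < 1]. *)
  assert (P : 0 < 1) by (exists 0; ring).
  cert 1 ((k + 1) * c) (k + 1) (b0 * c + k * a0 * c) P H. now apply w_mul_neq.
Qed.

Lemma real_add_bounded r s t m n : real_add r s t ->
  subset r (cut (val m)) -> subset s (cut (val n)) -> subset t (cut (val (m + n))).
Proof.
  intros H Hr Hs q Hq. apply H in Hq as (x & y & z & Hx & Hy & Hz & Hq).
  apply (cut_down _ z); [|exact Hq].
  apply frac_addE in Hz as (a & b & c & a' & b' & c' & Hc & Hc' & -> & -> & ->).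
  apply Hr, mk_in_cut in Hx; [|exact Hc]. apply Hs, mk_in_cut in Hy; [|exact Hc'].
  apply mk_in_cut; [now apply w_mul_neq|].
  cert 1 c' c 0 Hx (wlt_wle _ _ Hy). exact Hc'.
Qed.

Lemma real_add_exists (r s : V) : exists t, real_add r s t.
Proof.
  destruct (separation (fun q => exists x y z, x ∈ r /\ y ∈ s /\ frac_add x y z /\ frac_lt q z)
    fractions _) as [t Ht].
  exists t; intros q; rewrite Ht. split; [tauto|]. intros H; split; [|exact H].
  destruct H as (x & y & z & _ & _ & _ & H). apply in_fractions, is_fracE.
  apply frac_lt_inv in H as (a & b & c & a' & b' & c' & Hc & _ & -> & _); eauto.
Qed.

(* A fraction [q < m] is below [(q + m) / 2 + (q - m) / 4], whose second summand is negative. *)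
Lemma cut_le_add m n t : real_add (cut (val m)) (cut (val n)) t -> subset (cut (val m)) t.
Proof.
  intros Ht q Hq. apply Ht. apply in_cut in Hq as (a & b & c & Hc & -> & H).
  assert (H2 : c * (1 + 1) <> 0) by (apply w_mul_neq; [exact Hc|apply w_neq_S]).
  assert (H4 : c * (1 + 1) * (1 + 1) <> 0) by (apply w_mul_neq; [exact H2|apply w_neq_S]).
  eexists (mk (a + m * c) b (c * (1 + 1))), (mk a (b + m * c) (c * (1 + 1) * (1 + 1))), _.
  rewrite frac_addE. split; [|split; [|split]].
  - apply mk_in_cut; [exact H2|]. cert 1 1 0 0 H (wle_refl 0). exact w1_neq.
  - apply mk_in_cut; [exact H4|].
    cert 1 1 0 (n * (c * (1 + 1) * (1 + 1))) H (wle_refl 0). exact w1_neq.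
  - do 6 eexists; split; [exact H2|]; split; [exact H4|]; split; [reflexivity|]; split; reflexivity.
  - apply frac_lt_intro; [exact Hc|now apply w_mul_neq|].
    cert 1 (c * c * (1 + 1)) 0 0 H (wle_refl 0).
    now repeat apply w_mul_neq; try apply w_neq_S.
Qed.

Definition reals : V := sep (power fractions) is_real.

Lemma in_reals r : r ∈ reals <-> is_real r.
Proof.
  unfold reals; rewrite in_sep by (unfold is_real, ext_real; exact _). split; [tauto|].
  intros H; split; [|exact H]. apply in_power; intros q Hq. apply in_fractions, H, Hq.
Qed.

Lemma is_realsE R : is_reals R <-> R = reals.
Proof.
  split; [|intros ->; exact in_reals].
  intros H; apply set_ext; intros r; now rewrite (H r), in_reals.
Qed.

Implicit Types A B C T X d f p x y z : V.

(** * Countable sets *)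

#[export] Instance definable_countable (t : (nat -> V) -> V) :
  DTerm t -> Definable (fun e => countable (t e)).
Proof. unfold countable, equipollent, is_bijection; exact _. Qed.

Lemma countable_of_injection A (t : V -> V) : DTerm (fun e => t (e O)) ->
  (forall x, x ∈ A -> is_nat (t x)) ->
  (forall x y, x ∈ A -> y ∈ A -> t x = t y -> x = y) -> countable A.
Proof.
  intros Ht Hn Hinj. exists omega, (image A t).
  split; [now apply is_omegaE|]. split.
  - intros y; rewrite in_image by exact _; intros [x [Hx ->]]. apply nat_omega, Hn, Hx.
  - exists (lam A t). split; [|split].
    + apply is_fun_lam; [exact _|]. intros x Hx; apply in_image; eauto.
    + intros x x' y H H'. apply value_lam in H as [Hx ->]; [|exact _].
      apply value_lam in H' as [Hx' E]; [|exact _]. auto.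
    + intros y Hy. apply in_image in Hy as [x [Hx ->]]; [|exact _].
      exists x; now apply value_lam.
Qed.

Lemma countable_injection A : countable A -> exists f,
  (forall x, x ∈ A -> is_nat (app f x)) /\
  (forall x y, x ∈ A -> y ∈ A -> app f x = app f y -> x = y).
Proof.
  intros (w & B & Hw & HB & f & Hf & Hinj & _). apply is_omegaE in Hw; subst w.
  exists f; split.
  - intros x Hx. apply in_omega, HB. eapply app_in; eauto.
  - intros x y Hx Hy E. apply (Hinj x y (app f x)); [|rewrite E]; eapply value_app; eauto.
Qed.

Lemma countable_subset A B : subset A B -> countable B -> countable A.
Proof.
  intros H [f [Hf Hinj]]%countable_injection.
  apply (countable_of_injection A (app f)); auto; exact _.
Qed.

Lemma nat_least (P : V -> Prop) : Definable (fun e => P (e O)) ->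
  (exists n, is_nat n /\ P n) -> exists! n, is_nat n /\ P n /\ forall m, is_nat m -> m ∈ n -> ~ P m.
Proof.
  intros HP [n [Hn Pn]].
  destruct (classic (exists n, is_nat n /\ P n /\ forall m, is_nat m -> m ∈ n -> ~ P m))
    as [[k (Hk & Pk & Mk)]|H].
  - exists k; split; [auto|]. intros j (Hj & Pj & Mj).
    destruct (nat_total k j Hk Hj) as [K|[K|K]].
    + destruct (Mj k Hk K Pk).
    + exact K.
    + destruct (Mk j Hj K Pj).
  - exfalso.
    (* Strong induction: if [P] has no least element, it fails below every natural number. *)
    assert (K : forall n, is_nat n -> forall m, is_nat m -> m ∈ n -> ~ P m).
    { apply (nat_ind (fun n => forall m, is_nat m -> m ∈ n -> ~ P m)).
      - pose proof (definable_reindex (fun _ => O) _ HP). cbv beta in *. exact _.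
      - intros m _ []%not_in_empty.
      - intros k Hk IH m Hm Hmk Pm.
        apply in_succ in Hmk as [Hmk| ->]; [exact (IH m Hm Hmk Pm)|].
        apply H; exists k; auto. }
    apply H; exists n; split; [exact Hn|]; split; [exact Pn|]. exact (K n Hn).
Qed.

(** The choice-free selector: a least natural number is unique, so it can be described and remains a
    definable term. *)
Definition least (P : V -> Prop) : V :=
  the (fun n => is_nat n /\ P n /\ forall m, is_nat m -> m ∈ n -> ~ P m).

#[export] Instance dterm_least (Q : (nat -> V) -> V -> Prop) :
  Definable (fun e => Q (fun n => e (S n)) (e O)) -> DTerm (fun e => least (Q e)).
Proof.
  intros HQ. unfold least.
  pose proof (definable_reindex (fun n => match n with O => O | S k => S (S k) end) _ HQ).
  cbv beta in H. exact _.
Qed.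

Lemma least_spec (P : V -> Prop) : Definable (fun e => P (e O)) ->
  (exists n, is_nat n /\ P n) -> is_nat (least P) /\ P (least P).
Proof.
  intros HP H. destruct (the_spec _ (nat_least P HP H)) as (H1 & H2 & _); auto.
Qed.

(** Sending each value to its least preimage is an injection into ω. *)
Lemma countable_image_omega (t : V -> V) : DTerm (fun e => t (e O)) -> countable (image omega t).
Proof.
  intros Ht.
  assert (D : forall i j, Definable (fun e : nat -> V => t (e i) = e j)).
  { intros i j. apply definable_eq; [|exact _].
    exact (dterm_reindex (fun _ => i) _ Ht). }
  assert (H : forall y, y ∈ image omega t ->
    is_nat (least (fun n => t n = y)) /\ t (least (fun n => t n = y)) = y).
  { intros y Hy. apply in_image in Hy as [n [Hn ->]]; [|exact _]. apply in_omega in Hn.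
    apply least_spec; [|exists n; auto].
    apply definable_eq; [exact Ht|exact _]. }
  apply (countable_of_injection _ (fun y => least (fun n => t n = y))).
  - apply dterm_least, D.
  - intros y Hy; now apply H.
  - intros x y Hx Hy E. apply H in Hx, Hy. rewrite <- (proj2 Hx), <- (proj2 Hy), E; reflexivity.
Qed.

(** An injective pairing of natural numbers, [(a + b)^2 + a]: Cantor's with a square for the
    triangular number, which avoids halving at the price of surjectivity. *)
Definition code (a b : V) : V := add (mul (add a b) (add a b)) a.

#[export] Instance dterm_code (t u : (nat -> V) -> V) :
  DTerm t -> DTerm u -> DTerm (fun e => code (t e) (u e)).
Proof. unfold code; exact _. Qed.

Lemma is_nat_code a b : is_nat a -> is_nat b -> is_nat (code a b).
Proof. intros; unfold code; auto using is_nat_add, is_nat_mul. Qed.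

(* [(a + b)^2 <= code a b < (a + b + 1)^2] determines [a + b]. *)
Lemma code_inj a b a' b' : is_nat a -> is_nat b -> is_nat a' -> is_nat b' ->
  code a b = code a' b' -> a = a' /\ b = b'.
Proof.
  intros Ha Hb Ha' Hb'.
  destruct (whole_of a Ha) as [x ->], (whole_of b Hb) as [y ->],
    (whole_of a' Ha') as [x' ->], (whole_of b' Hb') as [y' ->].
  unfold code; rewrite <- !val_add, <- !val_mul, <- !val_add.
  assert (K : forall x y x' y' : whole, x + y < x' + y' ->
    (x + y) * (x + y) + x < (x' + y') * (x' + y') + x').
  { intros a b a' b' [k ->].
    exists ((a + b) * k + (a + b) * k + a + b + b + k * k + k + k + a'); ring. }
  intros E; apply val_inj in E.
  assert (S : x + y = x' + y').
  { destruct (wlt_or_wle (x + y) (x' + y')) as [H|H].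
    - apply K in H; rewrite E in H; now apply wlt_irrefl in H.
    - destruct (wlt_or_wle (x' + y') (x + y)) as [H'|H']; [|now apply wle_antisym].
      apply K in H'; rewrite E in H'; now apply wlt_irrefl in H'. }
  rewrite S in E.
  assert (x = x') as ->.
  { apply (wadd_cancel _ _ ((x' + y') * (x' + y'))).
    etransitivity; [|etransitivity; [exact E|ring]]; ring. }
  split; [reflexivity|]. f_equal. apply (wadd_cancel _ _ x').
  etransitivity; [|etransitivity; [exact S|ring]]; ring.
Qed.

Lemma countable_union2 A B : countable A -> countable B -> countable (union2 A B).
Proof.
  intros [f [Hf If]]%countable_injection [g [Hg Ig]]%countable_injection.
  set (t x := ite (x ∈ A) (code empty (app f x)) (code (succ empty) (app g x))).
  assert (TA : forall x, x ∈ A -> t x = code empty (app f x)) by (intros; now apply iteT).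
  assert (TB : forall x, x ∉ A -> t x = code (succ empty) (app g x)) by (intros; now apply iteF).
  assert (E1 := is_nat_empty). assert (E2 := is_nat_succ _ E1).
  assert (E3 : empty <> succ empty) by (intros E; symmetry in E; now apply succ_neq_empty in E).
  assert (HB : forall x, x ∈ union2 A B -> x ∉ A -> x ∈ B)
    by (intros x Hx; apply in_union2 in Hx; tauto).
  apply (countable_of_injection _ t).
  - unfold t; exact _.
  - intros x Hx. destruct (classic (x ∈ A)) as [K|K]; [rewrite TA|rewrite TB];
      auto using is_nat_code.
  - intros x y Hx Hy.
    destruct (classic (x ∈ A)) as [K|K]; [rewrite (TA x)|rewrite (TB x)]; auto;
    (destruct (classic (y ∈ A)) as [L|L]; [rewrite (TA y)|rewrite (TB y)]); auto;
    intros E; apply code_inj in E as [E E']; auto; congruence.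
Qed.

Lemma countable_singleton x : countable (upair x x).
Proof.
  apply (countable_of_injection _ (fun _ => empty)); [exact _| |].
  - intros; apply is_nat_empty.
  - intros y z Hy Hz _; apply in_upair in Hy, Hz. intuition congruence.
Qed.

Lemma is_union2E C A B : is_union2 C A B -> C = union2 A B.
Proof. intros H; apply set_ext; intros z; now rewrite (H z), in_union2. Qed.

Lemma countable_bornology B X : is_countable_subsets B X -> is_bornology B X.
Proof.
  intros H; split; [|split; [|split; [|split]]].
  - intros A HA; now apply H.
  - exists empty; apply H; split; [intros z []%not_in_empty|].
    apply (countable_of_injection _ (fun _ => empty)); [exact _| |]; intros x ? []%not_in_empty || intros x []%not_in_empty.
  - intros A A' [H1 H2]%H HS; apply H; split; [|eapply countable_subset; eauto].
    intros z Hz; auto.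
  - intros A A' C [H1 H2]%H [H1' H2']%H ->%is_union2E. apply H; split.
    + intros z Hz; apply in_union2 in Hz as [Hz|Hz]; auto.
    + now apply countable_union2.
  - intros x C Hx ->%is_singletonE. apply H; split; [|apply countable_singleton].
    intros z Hz; apply in_upair in Hz; intuition congruence.
Qed.

(** * Distances and diameters *)

Lemma is_prodE P A B : is_prod P A B <-> P = prod A B.
Proof.
  assert (K : is_prod (prod A B) A B).
  { intros p; rewrite in_prod. split; intros (x & y & Hx & Hy & H); exists x, y;
      rewrite is_opairE in *; auto. }
  split; [|intros ->; exact K].
  intros H; apply set_ext; intros z; now rewrite (H z), (K z).
Qed.

Lemma distE d x y r : dist d x y r <-> value d (pair x y) r.
Proof.
  unfold dist; split.
  - intros [p [->%is_opairE H]]; exact H.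
  - intros H; exists (pair x y); split; [now apply is_opairE|exact H].
Qed.

(** The supremum of a set of cuts is their union, and an extended real other than +∞ omits some
    fraction and so lies below an integer. For void [A] the supremum is the empty cut -∞, which also
    counts as finite. *)
Lemma finite_diamE d A :
  (forall x y r, x ∈ A -> y ∈ A -> dist d x y r -> ext_real r) ->
  finite_diam d A <-> exists n : whole,
    forall x y r, x ∈ A -> y ∈ A -> dist d x y r -> subset r (cut (val n)).
Proof.
  intros Hd; split.
  - intros (s & t & (Hs & Hub & _) & Ht & _ & Hne).
    assert (H : exists q, is_frac q /\ q ∉ s).
    { apply NNPP; intros H; apply Hne, set_ext; intros q; rewrite (Ht q); split; [apply Hs|].
      intros Hq; apply NNPP; eauto. }
    destruct H as (q & Hq & Hqs). destruct (ext_real_bounded s q Hs Hq Hqs) as [n Hn].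
    exists n; intros x y r Hx Hy Hr z Hz. apply Hn, (Hub x y r); auto.
  - intros [n Hn].
    (* [s] is the union of all distances within [A], that is, the diameter. *)
    destruct (separation (fun q => exists x y r, x ∈ A /\ y ∈ A /\ dist d x y r /\ q ∈ r)
      fractions) as [s Hs]; [unfold dist; exact _|].
    assert (Hs' : forall q, q ∈ s <-> exists x y r, x ∈ A /\ y ∈ A /\ dist d x y r /\ q ∈ r).
    { intros q; rewrite Hs; split; [tauto|]. intros H; split; [|exact H].
      destruct H as (x & y & r & Hx & Hy & Hr & Hq). apply in_fractions, (Hd x y r); auto. }
    exists s, fractions. split; [split; [|split]|split; [|split]].
    + split; [|split].
      * intros q Hq. apply Hs in Hq as [Hq _]; now apply in_fractions.
      * intros q q' Hq Hlt. apply Hs' in Hq as (x & y & r & Hx & Hy & Hr & Hq).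
        apply Hs'; exists x, y, r. repeat (split; [assumption|]).
        destruct (Hd x y r Hx Hy Hr) as (_ & Hdown & _). eauto.
      * intros q Hq. apply Hs' in Hq as (x & y & r & Hx & Hy & Hr & Hq).
        destruct (Hd x y r Hx Hy Hr) as (_ & _ & Hup). destruct (Hup q Hq) as (q' & Hq' & Hlt).
        exists q'; split; [|exact Hlt]. apply Hs'; eauto 7.
    + intros x y r Hx Hy Hr q Hq. apply Hs'; eauto 7.
    + intros t _ Ht q Hq. apply Hs' in Hq as (x & y & r & Hx & Hy & Hr & Hq).
      apply (Ht x y r); auto.
    + intros q; apply in_fractions.
    + intros q Hq; now apply Hs in Hq.
    + intros E. apply (wlt_irrefl n), unit_in_cut.
      (* The fraction [n/1] shows that the diameter is not +∞: it belongs to no distance bounded by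
         the cut at [n]. *)
      assert (H : mk n 0 1 ∈ s).
      { rewrite E; apply in_fractions, is_fracE; eauto using w1_neq. }
      apply Hs' in H as (x & y & r & Hx & Hy & Hr & Hq). apply (Hn x y r); auto.
Qed.

Definition fst p : V := the (fun x => exists y, p = pair x y).
Definition snd p : V := the (fun y => exists x, p = pair x y).

#[export] Instance dterm_fst t : DTerm t -> DTerm (fun e => fst (t e)).
Proof. unfold fst; exact _. Qed.
#[export] Instance dterm_snd t : DTerm t -> DTerm (fun e => snd (t e)).
Proof. unfold snd; exact _. Qed.

Lemma fst_pair x y : fst (pair x y) = x.
Proof. apply the_eq; [eauto|]. intros z [u E]; now apply pair_inj in E. Qed.
Lemma snd_pair x y : snd (pair x y) = y.
Proof. apply the_eq; [eauto|]. intros z [u E]; now apply pair_inj in E. Qed.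

Definition wmax (m n : whole) : whole := if excluded_middle_informative (m < n) then n else m.

Lemma wmax_spec m n : m <= wmax m n /\ n <= wmax m n /\ (wmax m n = m \/ wmax m n = n).
Proof.
  unfold wmax; destruct excluded_middle_informative as [H|H].
  - auto using wlt_wle, wle_refl.
  - destruct (wlt_or_wle m n); [contradiction|]. auto using wle_refl.
Qed.

Lemma wle_trans a b c : a <= b -> b <= c -> a <= c.
Proof. intros [k ->] [j ->]; exists (k + j); ring. Qed.

Lemma wlt_iff a b : a < b <-> a + 1 <= b.
Proof. split; intros [k ->]; exists k; ring. Qed.

Lemma wle_add1 a b : a <= b -> a + 1 <= b + 1.
Proof. intros [k ->]; exists k; ring. Qed.

(** * The metric of a rank function *)

Section RankMetric.
Variables (X rho : V).
Hypothesis rho_nat : forall x, x ∈ X -> is_nat (app rho x).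

(** The default value 0 makes the rank total, so that the laws of [gap] hold without membership
    hypotheses. *)
Definition rank (x : V) : whole :=
  match excluded_middle_informative (is_nat (app rho x)) with
  | left h => exist _ _ h
  | right _ => 0
  end.

Lemma val_rank x : x ∈ X -> val (rank x) = app rho x.
Proof.
  intros Hx; unfold rank. destruct excluded_middle_informative as [h|h]; [reflexivity|].
  destruct (h (rho_nat x Hx)).
Qed.

Definition gap (x y : V) : whole :=
  if excluded_middle_informative (x = y) then 0 else wmax (rank x) (rank y) + 1.

Lemma gap_refl x : gap x x = 0.
Proof. unfold gap; destruct excluded_middle_informative; congruence. Qed.

Lemma gap_neq x y : x <> y -> gap x y = wmax (rank x) (rank y) + 1.
Proof. unfold gap; destruct excluded_middle_informative; congruence. Qed.

Lemma gap_0 x y : gap x y = 0 <-> x = y.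
Proof.
  split; [|intros ->; apply gap_refl].
  unfold gap; destruct excluded_middle_informative as [|_]; [auto|]. intros []%w_neq_S.
Qed.

Lemma wmax_comm m n : wmax m n = wmax n m.
Proof.
  destruct (wmax_spec m n) as (H1 & H2 & H3), (wmax_spec n m) as (K1 & K2 & K3).
  apply wle_antisym; [destruct H3 as [->| ->]|destruct K3 as [->| ->]]; assumption.
Qed.

Lemma gap_sym x y : gap x y = gap y x.
Proof.
  destruct (classic (x = y)) as [->|H]; [reflexivity|].
  rewrite !gap_neq, wmax_comm by auto; reflexivity.
Qed.

Lemma gap_lower x y : x <> y -> rank x < gap x y.
Proof.
  intros H; rewrite gap_neq by exact H. apply wlt_iff, wle_add1, wmax_spec.
Qed.

Lemma gap_upper x y n : rank x < n -> rank y < n -> gap x y <= n.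
Proof.
  intros Hx%wlt_iff Hy%wlt_iff. destruct (classic (x = y)) as [->|H].
  - rewrite gap_refl; exists n; ring.
  - rewrite gap_neq by exact H.
    destruct (wmax_spec (rank x) (rank y)) as (_ & _ & [->| ->]); assumption.
Qed.

(** For distinct neighbours, either [rank z] is below [gap x y], which then exceeds both [rank x]
    and [rank z]; or [rank x < gap x y <= rank z < gap y z], and [gap y z] exceeds both. *)
Lemma gap_ultra x y z : gap x z <= gap x y \/ gap x z <= gap y z.
Proof.
  destruct (classic (x = y)) as [->|Hxy]; [right; apply wle_refl|].
  destruct (classic (y = z)) as [->|Hyz]; [left; apply wle_refl|].
  destruct (wlt_or_wle (rank z) (gap x y)) as [H|H].
  - left; apply gap_upper; [now apply gap_lower|exact H].
  - right. apply gap_upper; [|rewrite gap_sym; apply gap_lower; congruence].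
    apply wlt_iff. apply wle_trans with (gap x y); [now apply wlt_iff, gap_lower|].
    apply wle_trans with (rank z); [exact H|]. apply wlt_wle.
    rewrite gap_sym; apply gap_lower; congruence.
Qed.

(** The internal counterpart of [gap]: that one is convenient for [ring] but lives in the
    metatheory, whereas forming the metric as a set needs a definable term. *)
Let height (x y : V) : V :=
  ite (x = y) empty (ite (app rho x ∈ app rho y) (succ (app rho y)) (succ (app rho x))).

Lemma height_gap x y : x ∈ X -> y ∈ X -> height x y = val (gap x y).
Proof.
  intros Hx Hy; unfold height. destruct (classic (x = y)) as [->|H].
  - now rewrite iteT, gap_refl.
  - rewrite iteF, gap_neq by exact H. rewrite <- !val_rank by assumption.
    unfold wmax; destruct excluded_middle_informative as [K|K].
    + rewrite iteT by (now apply val_lt). apply val_succ.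
    + rewrite iteF by (now rewrite val_lt). apply val_succ.
Qed.

Definition rank_metric : V := lam (prod X X) (fun p => cut (height (fst p) (snd p))).

Lemma dterm_height : DTerm (fun e => cut (height (fst (e O)) (snd (e O)))).
Proof. unfold height; exact _. Qed.

Lemma dist_rank_metric x y r :
  dist rank_metric x y r <-> x ∈ X /\ y ∈ X /\ r = cut (val (gap x y)).
Proof.
  rewrite distE; unfold rank_metric.
  rewrite value_lam, pair_in_prod, fst_pair, snd_pair by exact dterm_height.
  split.
  - intros [[Hx Hy] ->]. now rewrite height_gap.
  - intros (Hx & Hy & ->). now rewrite height_gap.
Qed.

Lemma is_metric_rank_metric : is_metric rank_metric X.
Proof.
  split; [|split; [|split; [|split]]].
  - exists (prod X X), reals. rewrite is_prodE, is_realsE. repeat (split; [reflexivity|]).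
    apply is_fun_lam; [exact dterm_height|]. intros p Hp.
    apply in_prod in Hp as (x & y & Hx & Hy & ->).
    rewrite fst_pair, snd_pair, height_gap by assumption. apply in_reals, is_real_cut.
  - intros x y r (Hx & Hy & ->)%dist_rank_metric. apply is_nonneg_cut.
  - intros x y r (Hx & Hy & ->)%dist_rank_metric. rewrite is_zeroE, <- (gap_0 x y).
    split; [apply cut_inj|congruence].
  - intros x y r (Hx & Hy & ->)%dist_rank_metric. apply dist_rank_metric.
    now rewrite gap_sym.
  - intros x y z r s t (Hx & Hz & ->)%dist_rank_metric (_ & Hy & ->)%dist_rank_metric
      (_ & _ & ->)%dist_rank_metric.
    destruct (real_add_exists (cut (val (gap x y))) (cut (val (gap y z)))) as [u Hu].
    exists u; split; [exact Hu|].
    destruct (gap_ultra x y z) as [H|H]; intros q Hq; apply (cut_mono _ _ H) in Hq.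
    + now apply (cut_le_add _ _ _ Hu).
    + now apply (cut_le_add _ _ _ (real_add_comm _ _ _ Hu)).
Qed.

Lemma finite_diam_rank_metric A : subset A X ->
  finite_diam rank_metric A <-> exists n, is_nat n /\ forall x, x ∈ A -> app rho x ∈ n.
Proof.
  intros HA. rewrite finite_diamE.
  2:{ intros x y r _ _ (_ & _ & ->)%dist_rank_metric. apply ext_real_cut. }
  split.
  - intros [n Hn].
    destruct (classic (nonvoid A)) as [[a Ha]|H].
    (* A point [x] other than [a] has [rank x < gap x a <= n]; the summand [rank a + 1] accommodates
       [a] itself, whose rank the diameter does not control when [A] is a singleton. *)
    + exists (val (n + rank a + 1)); split; [apply val_nat|]. intros x Hx.
      rewrite <- val_rank, val_lt by auto.
      destruct (classic (x = a)) as [->|Hxa]; [exists n; ring|].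
      assert (K : gap x a <= n).
      { apply cut_le_inv, (Hn x a); auto. apply dist_rank_metric; auto. }
      apply wlt_iff. apply wle_trans with n; [|exists (rank a + 1); ring].
      apply wle_trans with (gap x a); [|exact K]. now apply wlt_iff, gap_lower.
    + exists empty; split; [apply is_nat_empty|]. intros x Hx; destruct H; now exists x.
  - intros (n & Hn & H). destruct (whole_of n Hn) as [m ->]. exists m.
    intros x y r Hx Hy (_ & _ & ->)%dist_rank_metric. apply cut_mono, gap_upper;
      apply val_lt; rewrite val_rank; auto.
Qed.

Lemma induced_rank_metric T : discrete_space X T -> is_induced_topology T X rank_metric.
Proof.
  intros [[HT _] Hdisc] U; split; [|intros [H _]; now apply Hdisc].
  intros HU; split; [now apply HT|]. intros x Hx.
  (* Distinct points are at distance at least 1, so an open ball of radius 1 is a single point. *)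
  exists (cut (val 1)); split; [apply is_pos_cut; exists 0; ring|].
  intros y r Hy (Hx' & _ & ->)%dist_rank_metric [H1 H2].
  destruct (classic (x = y)) as [<-|Hxy]; [exact Hx|exfalso].
  apply H2. f_equal; f_equal. apply wle_antisym; [now apply cut_le_inv|].
  rewrite gap_neq by exact Hxy. exists (wmax (rank x) (rank y)); ring.
Qed.

End RankMetric.

(** Bounded sets of the rank metric are the sets of bounded rank, so metrizability reduces to a rank
    under which the countable subsets are exactly those of bounded rank. *)
Lemma metrizable_of_rank X T B rho : discrete_space X T -> is_countable_subsets B X ->
  (forall x, x ∈ X -> is_nat (app rho x)) ->
  (forall A, subset A X ->
    (countable A <-> exists n, is_nat n /\ forall x, x ∈ A -> app rho x ∈ n)) ->
  metrizable X T B.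
Proof.
  intros HT HB Hrho H. split; [split; [apply HT|now apply countable_bornology]|].
  exists (rank_metric X rho).
  split; [now apply is_metric_rank_metric|]. split; [now apply induced_rank_metric|].
  intros A; rewrite (HB A). split; intros [HA K]; (split; [exact HA|]).
  - now apply finite_diam_rank_metric, H.
  - apply H; [exact HA|]. now apply finite_diam_rank_metric in K.
Qed.

(** * Metrizability of countable spaces, and countability from choice *)

Implicit Types F g n w : V.

Definition countable_choice : Prop := forall w F, is_omega w -> is_family F w ->
  (forall n A, n ∈ w -> value F n A -> nonvoid A /\ countable A) ->
  exists f, in_product f F w.

Lemma countable_empty A : ~ nonvoid A -> countable A.
Proof.
  intros H; apply (countable_of_injection A (fun _ => empty)); [exact _| |].
  - intros x Hx; destruct H; now exists x.
  - intros x y Hx; destruct H; now exists x.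
Qed.

Lemma metrizable_of_countable X T B : discrete_space X T -> is_countable_subsets B X ->
  countable X -> metrizable X T B.
Proof.
  (* Constant rank 0 gives the metric with values 0 and 1, for which every subset is bounded. *)
  intros HT HB HX. apply (metrizable_of_rank X T B (lam X (fun _ => empty))); auto.
  - intros x Hx; rewrite app_lam by (exact _ || exact Hx). apply is_nat_empty.
  - intros A HA; split.
    + intros _; exists (succ empty); split; [apply is_nat_succ, is_nat_empty|].
      intros x Hx; rewrite app_lam by (exact _ || auto). apply in_succ; auto.
    + intros _; now apply (countable_subset A X).
Qed.

Section CountableOfMetrizable.
Variables X d x0 : V.
Hypothesis Hd : is_metric d X.
Hypothesis Hx0 : x0 ∈ X.
Hypothesis bounded_iff_countable : forall A, subset A X -> (countable A <-> finite_diam d A).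

Let norm x := app d (pair x0 x).

Lemma metric_fun : is_fun d (prod X X) reals.
Proof.
  destruct Hd as [(P & R & HP & HR & Hf) _].
  apply is_prodE in HP; apply is_realsE in HR; now subst.
Qed.

Lemma dist_inv x y r : dist d x y r -> x ∈ X /\ y ∈ X /\ is_real r.
Proof.
  intros H%distE. apply (value_in _ _ _ _ _ metric_fun) in H.
  rewrite pair_in_prod, in_reals in H. tauto.
Qed.

Lemma dist_norm x : x ∈ X -> dist d x0 x (norm x).
Proof.
  intros Hx; apply distE. eapply value_app; [exact metric_fun|]. now apply pair_in_prod.
Qed.

Lemma finite_diam_iff A : finite_diam d A <-> exists n : whole,
    forall x y r, x ∈ A -> y ∈ A -> dist d x y r -> subset r (cut (val n)).
Proof. apply finite_diamE. intros x y r _ _ H; exact (proj1 (proj2 (proj2 (dist_inv _ _ _ H)))). Qed.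

(** By the triangle inequality through [x0], a set within distance [n] of [x0] has diameter at most
    [n + n]. *)
Lemma countable_of_norm_bounded A (n : whole) : subset A X ->
  (forall x, x ∈ A -> subset (norm x) (cut (val n))) -> countable A.
Proof.
  intros HA H. apply bounded_iff_countable; [exact HA|]. apply finite_diam_iff.
  exists (n + n). intros x y r Hx Hy Hr.
  destruct Hd as (_ & _ & _ & Hsym & Htri).
  destruct (Htri x x0 y r (norm x) (norm y) Hr) as (u & Hu & Hru);
    [apply Hsym, dist_norm; auto|apply dist_norm; auto|].
  intros q Hq. apply (real_add_bounded _ _ _ _ _ Hu (H x Hx) (H y Hy)), Hru, Hq.
Qed.

(** Adjoining [x0] keeps [A] countable, and the diameter of the enlarged set bounds the distances
    from [x0]. *)
Lemma norm_bounded_of_countable A : subset A X -> countable A ->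
  exists n : whole, forall x, x ∈ A -> subset (norm x) (cut (val n)).
Proof.
  intros HA Hc.
  assert (HA' : subset (union2 A (upair x0 x0)) X).
  { intros x Hx; rewrite in_union2, in_upair in Hx. intuition (subst; auto). }
  assert (K : finite_diam d (union2 A (upair x0 x0))).
  { apply bounded_iff_countable; [exact HA'|].
    apply countable_union2; [exact Hc|apply countable_singleton]. }
  apply finite_diam_iff in K as [n Hn]. exists n; intros x Hx.
  apply (Hn x0 x); [..|apply dist_norm; auto]; apply in_union2; rewrite ?in_upair; auto.
Qed.

Lemma norm_bounded x : x ∈ X -> exists n : whole, subset (norm x) (cut (val n)).
Proof.
  intros Hx. destruct (dist_inv _ _ _ (dist_norm x Hx)) as (_ & _ & Hr & _ & q & Hq & Hnq).
  now apply (ext_real_bounded _ q).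
Qed.

Let annulus n := sep X (fun x => subset (norm x) (cut (succ n)) /\ ~ subset (norm x) (cut n)).
(** The choice principle requires every factor to be nonvoid, so a void annulus is replaced by the
    singleton of [x0]. *)
Let annuli n := ite (nonvoid (annulus n)) (annulus n) (upair x0 x0).

Lemma in_annulus n x : x ∈ annulus n <->
  x ∈ X /\ subset (norm x) (cut (succ n)) /\ ~ subset (norm x) (cut n).
Proof. unfold annulus; rewrite in_sep by (unfold norm; exact _); reflexivity. Qed.

Lemma annuli_subset n : subset (annuli n) X.
Proof.
  intros x Hx. destruct (classic (nonvoid (annulus n))) as [H|H].
  - unfold annuli in Hx; rewrite iteT in Hx by exact H. now apply in_annulus in Hx.
  - unfold annuli in Hx; rewrite iteF in Hx by exact H. apply in_upair in Hx. intuition congruence.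
Qed.

Lemma annuli_nonvoid n : nonvoid (annuli n).
Proof.
  unfold annuli; destruct (classic (nonvoid (annulus n))) as [H|H].
  - now rewrite iteT.
  - rewrite iteF by exact H; exists x0; apply in_upair; auto.
Qed.

Lemma annuli_countable n : is_nat n -> countable (annuli n).
Proof.
  intros Hn; unfold annuli; destruct (classic (nonvoid (annulus n))) as [H|H].
  - rewrite iteT by exact H. destruct (whole_of n Hn) as [m ->].
    apply (countable_of_norm_bounded _ (m + 1)).
    + intros x Hx; now apply in_annulus in Hx.
    + intros x Hx; apply in_annulus in Hx. rewrite <- val_succ. apply Hx.
  - rewrite iteF by exact H. apply countable_singleton.
Qed.

Lemma dterm_annuli : DTerm (fun e => annuli (e O)).
Proof. unfold annuli, annulus, norm; exact _. Qed.

Lemma countable_of_metric : countable_choice -> countable X.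
Proof.
  intros CC; pose proof dterm_annuli as DA.
  destruct (CC omega (lam omega annuli)) as (f & [C Hf] & Hin).
  { now apply is_omegaE. }
  { exists (image omega annuli). apply is_fun_lam; [exact _|]. intros n Hn; apply in_image; eauto. }
  { intros n A Hn HA. apply value_lam in HA as [_ ->]; [|exact _]. apply in_omega in Hn.
    auto using annuli_nonvoid, annuli_countable. }
  assert (Hfn : forall n, is_nat n -> app f n ∈ annuli n).
  { intros n Hn%nat_omega. apply (Hin n (annuli n)); [exact Hn|now apply value_lam|].
    eapply value_app; eauto. }
  (* The chosen points form a countable set, hence all lie within some distance [N] of [x0]. *)
  destruct (norm_bounded_of_countable (image omega (app f))) as [N HN].
  { intros x Hx; apply in_image in Hx as (n & Hn & ->); [|exact _].
    apply (annuli_subset n), Hfn, in_omega, Hn. }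
  { apply countable_image_omega; exact _. }
  apply NNPP; intros Hnc.
  assert (H : exists x, x ∈ X /\ ~ subset (norm x) (cut (val N))).
  { apply NNPP; intros H; apply Hnc, (countable_of_norm_bounded X N); [exact (fun z Hz => Hz)|].
    intros x Hx; apply NNPP; eauto. }
  destruct H as (x & Hx & HxN).
  (* The least integer radius [m] that reaches [x] locates its annulus: [m = k + 1] puts [x] in
     annulus [k], while [m = 0] contradicts that [x] is farther than [N]. *)
  destruct (nat_least (fun m => subset (norm x) (cut m))) as [m [(Hm & Pm & Mm) _]].
  { exact _. }
  { destruct (norm_bounded x Hx) as [n Hn]; exists (val n); auto using val_nat. }
  destruct (whole_of m Hm) as [M ->].
  destruct (classic (M = 0)) as [->|[k ->]%w_pos].
  { apply HxN; intros q Hq%Pm. revert Hq; apply cut_mono. exists N; ring. }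
  assert (Hk : x ∈ annulus (val k)).
  { apply in_annulus; rewrite val_succ. split; [exact Hx|]. split; [exact Pm|].
    apply Mm; [apply val_nat|]. apply val_lt. exists 0; ring. }
  assert (Hfk : app f (val k) ∈ annulus (val k)).
  { generalize (Hfn _ (val_nat k)); unfold annuli. rewrite iteT; [auto|]. now exists x. }
  apply in_annulus in Hfk as (_ & _ & Hfk).
  assert (HNk : subset (norm (app f (val k))) (cut (val N))).
  { apply HN, in_image; [exact _|]. exists (val k); split; [apply nat_omega, val_nat|reflexivity]. }
  (* If [k < N], then [x] is within [k + 1 <= N]. If [N <= k], the point chosen in annulus [k] is
     within [N <= k] although it lies beyond [k]. *)
  destruct (wlt_or_wle k N) as [K|K].
  - apply HxN; intros q Hq%Pm. revert Hq; apply cut_mono. exact (proj1 (wlt_iff _ _) K).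
  - apply Hfk; intros q Hq%HNk. revert Hq; now apply cut_mono.
Qed.
End CountableOfMetrizable.

Lemma countable_of_metrizable X T B : countable_choice -> is_countable_subsets B X ->
  metrizable X T B -> countable X.
Proof.
  intros CC HB [_ (d & Hd & _ & HBd)].
  destruct (classic (nonvoid X)) as [[x0 Hx0]|H]; [|now apply countable_empty].
  apply (countable_of_metric X d x0); auto.
  intros A HA; generalize (HB A), (HBd A); tauto.
Qed.

(** * Finite choice functions, and choice from metrizability *)

Lemma mem_nat n i : is_nat n -> i ∈ n -> is_nat i.
Proof.
  intros Hn; revert n Hn i. apply (nat_ind (fun n => forall i, i ∈ n -> is_nat i)).
  - exact _.
  - intros i []%not_in_empty.
  - intros n Hn IH i [Hi| ->]%in_succ; auto.
Qed.

Lemma lam_ext A (t u : V -> V) : DTerm (fun e => t (e O)) -> DTerm (fun e => u (e O)) ->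
  (forall x, x ∈ A -> t x = u x) -> lam A t = lam A u.
Proof.
  intros Ht Hu H; apply set_ext; intros p; unfold lam; rewrite !in_image by exact _.
  split; intros (x & Hx & ->); exists x; split; rewrite ?H; auto.
Qed.

Lemma fun_ext f g A B C : is_fun f A B -> is_fun g A C ->
  (forall x, x ∈ A -> app f x = app g x) -> f = g.
Proof.
  intros Hf Hg H. rewrite (is_fun_of_lam f A B Hf), (is_fun_of_lam g A C Hg).
  apply lam_ext; [exact _..|exact H].
Qed.

Section ChoiceOfMetrization.
Variables F C : V.
Hypothesis HF : is_fun F omega C.
Hypothesis F_nonvoid : forall n, is_nat n -> nonvoid (app F n).
Hypothesis F_countable : forall n, is_nat n -> countable (app F n).

Lemma in_union_F n x : is_nat n -> x ∈ app F n -> x ∈ union C.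
Proof.
  intros Hn Hx; apply in_union; exists (app F n); split; [|exact Hx].
  eapply app_in; [exact HF|]. now apply nat_omega.
Qed.

Definition partial_choice n g : Prop :=
  is_fun g n (union C) /\ forall i, i ∈ n -> app g i ∈ app F i.

Instance definable_partial_choice (t u : (nat -> V) -> V) : DTerm t -> DTerm u ->
  Definable (fun e => partial_choice (t e) (u e)).
Proof. unfold partial_choice; exact _. Qed.

(** The set [Y] of the overview. The length is stored next to the function, so that the rank is a
    projection. *)
Definition choices : V := sep (prod omega (power (prod omega (union C))))
  (fun p => partial_choice (fst p) (snd p)).

#[local] Typeclasses Opaque partial_choice choices.

Lemma pair_in_choices n g : pair n g ∈ choices <-> is_nat n /\ partial_choice n g.
Proof.
  unfold choices; rewrite in_sep, pair_in_prod, in_omega, fst_pair, snd_pair by exact _.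
  split; [tauto|]. intros [Hn Hg]; split; [split; [exact Hn|]|exact Hg].
  apply in_power. intros p Hp. destruct Hg as [[Hg _] _].
  destruct (Hg p Hp) as (x & y & Hx & Hy & ->%is_opairE).
  apply pair_in_prod; split; [|exact Hy]. apply nat_omega, (mem_nat n); assumption.
Qed.

Lemma in_choices p : p ∈ choices ->
  exists n g, p = pair n g /\ is_nat n /\ partial_choice n g.
Proof.
  intros Hp; assert (Hp' := Hp). unfold choices in Hp'; rewrite in_sep in Hp' by exact _.
  destruct Hp' as [H _]. apply in_prod in H as (n & g & _ & _ & ->).
  exists n, g; split; [reflexivity|]. now apply pair_in_choices.
Qed.

(** Finite choice is provable in ZF: each step of the induction extends one function by one element
    of [F n], under an existential quantifier. *)
Lemma partial_choice_exists n : is_nat n -> exists g, partial_choice n g.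
Proof.
  revert n; apply nat_ind.
  - exact _.
  - exists (lam empty (fun x => x)). split.
    + apply is_fun_lam; [exact _|]. intros x []%not_in_empty.
    + intros x []%not_in_empty.
  - intros n Hn [g [Hg Hin]]. destruct (F_nonvoid n Hn) as [x Hx].
    assert (K : forall i, i ∈ succ n -> ite (i = n) x (app g i) ∈ app F i).
    { intros i Hi. destruct (classic (i = n)) as [->|Hne]; [now rewrite iteT|].
      rewrite iteF by exact Hne. apply Hin. apply in_succ in Hi; tauto. }
    exists (lam (succ n) (fun i => ite (i = n) x (app g i))). split.
    + apply is_fun_lam; [exact _|]. intros i Hi. apply (in_union_F i); [|now apply K].
      apply (mem_nat (succ n)); auto using is_nat_succ.
    + intros i Hi. rewrite app_lam by (exact _ || exact Hi). now apply K.
Qed.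

Lemma partial_choice_restrict n g : is_nat n -> partial_choice (succ n) g ->
  partial_choice n (lam n (app g)).
Proof.
  intros Hn [Hg Hin].
  assert (K : forall i, i ∈ n -> i ∈ succ n) by (intros; apply in_succ; auto). split.
  - apply is_fun_lam; [exact _|]. intros i Hi. eapply app_in; eauto.
  - intros i Hi. rewrite app_lam by (exact _ || exact Hi). auto.
Qed.

(** A function of length [n + 1] is coded by its restriction to [n] and its last value. The
    induction asserts only that an injection exists for each length; a sequence of injections would
    make all of [choices] countable without choice. *)
Lemma countable_partial_choices n : is_nat n ->
  countable (sep choices (fun p => fst p = n)).
Proof.
  revert n; apply nat_ind.
  - exact _.
  (* There is at most one function of length 0, so a constant map is injective. *)
  - apply (countable_of_injection _ (fun _ => empty)); [exact _|intros; apply is_nat_empty|].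
    intros p q Hp Hq _. rewrite in_sep in Hp, Hq by exact _.
    destruct Hp as [Hp Ep], Hq as [Hq Eq].
    apply in_choices in Hp as (n & g & -> & Hn & Hg & _), Hq as (m & h & -> & Hm & Hh & _).
    rewrite fst_pair in Ep, Eq; subst. f_equal. eapply fun_ext; eauto.
    intros x []%not_in_empty.
  - intros n Hn [e [He Ie]]%countable_injection.
    destruct (countable_injection _ (F_countable n Hn)) as [h [Hh Ih]].
    set (S := sep choices (fun p => fst p = n)) in *.
    assert (K : forall p, p ∈ sep choices (fun p => fst p = succ n) -> exists g,
      p = pair (succ n) g /\ is_fun g (succ n) (union C) /\ app g n ∈ app F n /\
      pair n (lam n (app g)) ∈ S).
    { intros p Hp. rewrite in_sep in Hp by exact _. destruct Hp as [Hp Ep].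
      apply in_choices in Hp as (m & g & -> & Hm & Hg). rewrite fst_pair in Ep; subst m.
      exists g. split; [reflexivity|]. split; [apply Hg|]. split; [apply Hg, in_succ; auto|].
      unfold S; rewrite in_sep, fst_pair by exact _. split; [|reflexivity].
      apply pair_in_choices; auto using partial_choice_restrict. }
    apply (countable_of_injection _
      (fun p => code (app e (pair n (lam n (app (snd p))))) (app h (app (snd p) n)))).
    + exact _.
    + intros p Hp; apply K in Hp as (g & -> & _ & Hg & HS). rewrite snd_pair.
      apply is_nat_code; auto.
    + intros p q Hp Hq; apply K in Hp as (g & -> & Fg & Hg & HS), Hq as (g' & -> & Fg' & Hg' & HS').
      rewrite !snd_pair. intros E; apply code_inj in E as [E1 E2]; auto.
      apply Ie in E1; [|assumption..]. apply Ih in E2; [|assumption..].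
      f_equal. eapply fun_ext; eauto. apply pair_inj in E1 as [_ E1].
      intros x [Hx| ->]%in_succ; [|exact E2].
      now rewrite <- (app_lam n (app g) x _ Hx), E1, app_lam by (exact _ || exact Hx).
Qed.

Lemma countable_bounded_choices n : is_nat n -> countable (sep choices (fun p => fst p ∈ n)).
Proof.
  revert n; apply nat_ind.
  - exact _.
  - apply countable_empty. intros [p Hp]. rewrite in_sep in Hp by exact _.
    destruct Hp as [_ []%not_in_empty].
  - intros n Hn IH.
    eapply countable_subset; [|exact (countable_union2 _ _ IH (countable_partial_choices n Hn))].
    intros p Hp. rewrite in_sep, in_succ in Hp by exact _. rewrite in_union2, !in_sep by exact _.
    tauto.
Qed.

Lemma choice_of_countable_unbounded A : subset A choices -> countable A ->
  (forall n, is_nat n -> exists p, p ∈ A /\ fst p ∉ n) -> exists f, in_product f F omega.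
Proof.
  intros HA [h [Hh Ih]]%countable_injection Hunb.
  (* Members of [A] cannot be minimized directly, so their codes under [h] are; [pick] recovers the
     member from its code, which is unique by injectivity. *)
  set (first n := least (fun c => exists p, p ∈ A /\ n ∈ fst p /\ c = app h p)).
  set (pick n := the (fun p => p ∈ A /\ app h p = first n)).
  assert (Hpick : forall n, is_nat n -> pick n ∈ A /\ n ∈ fst (pick n)).
  { intros n Hn.
    assert (K : is_nat (first n) /\ exists p, p ∈ A /\ n ∈ fst p /\ first n = app h p).
    { apply (least_spec (fun c => exists p, p ∈ A /\ n ∈ fst p /\ c = app h p)); [exact _|].
      (* Unboundedness at [n] would give only length at least [n]; position [n] must lie in the
         domain, hence the successor. *)
      destruct (Hunb (succ n) (is_nat_succ n Hn)) as (p & Hp & Hnp).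
      exists (app h p); split; [auto|]. exists p; split; [exact Hp|]. split; [|reflexivity].
      destruct (in_choices p (HA p Hp)) as (m & g & -> & Hm & _). rewrite fst_pair in *.
      rewrite in_succ in Hnp.
      destruct (nat_total n m Hn Hm) as [L|[L|L]]; [exact L|destruct Hnp; auto|destruct Hnp; auto]. }
    destruct K as (_ & p & Hp & Hnp & E).
    replace (pick n) with p; [auto|]. symmetry; apply the_eq; [auto|].
    intros q [Hq Eq]. apply Ih; congruence. }
  assert (D : DTerm (fun e => app (snd (pick (e O))) (e O))) by (unfold pick, first; exact _).
  assert (Hf : forall n, is_nat n -> app (snd (pick n)) n ∈ app F n).
  { intros n Hn. destruct (Hpick n Hn) as [Hp Hnp].
    destruct (in_choices _ (HA _ Hp)) as (m & g & E & Hm & Hg).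
    rewrite E in *. rewrite fst_pair in Hnp. rewrite snd_pair. now apply Hg. }
  exists (lam omega (fun n => app (snd (pick n)) n)). split.
  - exists (union C). apply is_fun_lam; [exact _|]. intros n Hn; apply in_omega in Hn.
    apply (in_union_F n); auto.
  - intros n B x Hn HB Hx. apply value_lam in Hx as [_ ->]; [|exact _].
    rewrite <- (app_eq _ _ _ _ _ HF HB). apply in_omega in Hn; auto.
Qed.

Lemma choice_of_metrization :
  (forall X T B, discrete_space X T -> is_countable_subsets B X ->
     metrizable X T B -> countable X) ->
  exists f, in_product f F omega.
Proof.
  intros H. apply NNPP; intros Hno.
  assert (Hrho : forall p, p ∈ choices -> app (lam choices fst) p = fst p)
    by (intros; apply app_lam; [exact _|assumption]).
  (* Here the assumed absence of a choice function is used: it makes every countable subset of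
     [choices] bounded in length. *)
  assert (Hbd : forall A, subset A choices -> countable A ->
    exists n, is_nat n /\ forall p, p ∈ A -> fst p ∈ n).
  { intros A HA Hc. apply NNPP; intros Hb. apply Hno, (choice_of_countable_unbounded A HA Hc).
    intros n Hn. apply NNPP; intros Hp. apply Hb; exists n; split; [exact Hn|].
    intros p HpA. apply NNPP; eauto. }
  destruct (separation countable (power choices) _) as [B HB].
  assert (HB' : is_countable_subsets B choices) by (intros A; now rewrite HB, in_power).
  assert (HT : discrete_space choices (power choices)).
  { split; [split; [|split; [|split; [|split]]]|].
    - intros U; apply in_power.
    - intros U HU; apply in_power. intros z Hz; destruct (HU z Hz).
    - apply in_power; exact (fun z Hz => Hz).
    - intros G U HG HU; apply in_power; intros z Hz. apply HU in Hz as (A & HA & Hz).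
      apply HG, in_power in HA. auto.
    - intros U U' D HU _ HD. apply in_power in HU; apply in_power.
      intros z Hz; apply HD in Hz; apply HU, Hz.
    - intros U; apply in_power. }
  assert (Hc : countable choices).
  { apply (H choices (power choices) B HT HB').
    apply (metrizable_of_rank choices (power choices) B (lam choices fst) HT HB').
    - intros p Hp; rewrite Hrho by exact Hp.
      destruct (in_choices p Hp) as (n & g & -> & Hn & _). now rewrite fst_pair.
    - intros A HA; split.
      + intros HcA; destruct (Hbd A HA HcA) as (n & Hn & K). exists n; split; [exact Hn|].
        intros p Hp; rewrite Hrho; auto.
      + intros (n & Hn & K). eapply countable_subset; [|exact (countable_bounded_choices n Hn)].
        intros p Hp; rewrite in_sep by exact _. rewrite <- Hrho by auto. auto. }
  (* All lengths would be below [n], yet a choice function of length exactly [n] exists, so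
     [n ∈ n]. *)
  destruct (Hbd choices (fun z Hz => Hz) Hc) as (n & Hn & K).
  destruct (partial_choice_exists n Hn) as [g Hg].
  specialize (K (pair n g) (proj2 (pair_in_choices n g) (conj Hn Hg))).
  rewrite fst_pair in K. destruct (whole_of n Hn) as [m ->].
  now apply val_lt, wlt_irrefl in K.
Qed.
End ChoiceOfMetrization.

End Reals.

Theorem theorem7p2 (V : set_structure) (hV : ZF V) :
  (forall w F : V, is_omega w -> is_family F w ->
     (forall n A : V, n ∈ w -> value F n A -> nonvoid A /\ countable A) ->
     exists f : V, in_product f F w)
  <->
  (forall X T B : V, discrete_space X T -> is_countable_subsets B X ->
     (metrizable X T B <-> countable X)).
Proof.
  split.
  - intros CC X T B HT HB; split.
    + now apply countable_of_metrizable.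
    + now apply metrizable_of_countable.
  - intros H w F Hw [C HF] HFn. apply is_omegaE in Hw; subst w.
    assert (K : forall n, is_nat n -> nonvoid (app F n) /\ countable (app F n)).
    { intros n Hn%nat_omega. apply (HFn n); [exact Hn|]. now apply (value_app F omega C). }
    apply (choice_of_metrization F C HF).
    + intros n Hn; now apply K.
    + intros n Hn; now apply K.
    + intros X T B HT HB; now apply H.
Qed.
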